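(* Let $d\ge 1$, let $S\subset\mathbb R^d$ be a regular simplex of unit side length, let $P\subseteq S$ be a convex body of diameter $1$, and let $0<\varepsilon<1$. Then there exist a nested barycentric system $B_t$ on $S$, obtained by always placing each new split point at the barycenter of the simplex of the current triangulation that contains it, and a weight vector $\vec w=(w_0,\dots,w_t)$ with entries in $\mathbb R\cup\{-\infty\}$, such that the set $$\tilde P=\{\vec x\in S:\ \vec w\cdot\phi_t(\vec x)\ge 0\}$$ satisfies: (1) $\operatorname{vol}(\tilde P\setminus P)<\varepsilon\operatorname{vol}(S)$; (2) $\tilde P^{(-\varepsilon)}\subseteq P\subseteq\tilde P$.
   Context: Nested barycentric system on a $d$-simplex $S\subset\mathbb R^d$ with vertices $q_0,\dots,q_d$: an ordered list of points $B_t=(q_0,\dots,q_t)$, $t\ge d$, together with a triangulation $\mathcal T_t$ of $S$, defined recursively. $B_d=(q_0,\dots,q_d)$ with $\mathcal T_d=\{S\}$. Given $B_{j}$ and $\mathcal T_{j}$, a point $q_{j+1}$ is chosen in the interior of some simplex $T\in\mathcal T_{j}$ with vertices $v_0,\dots,v_d$; then $\mathcal T_{j+1}$ is obtained from $\mathcal T_j$ by replacing $T$ with the $d+1$ simplices obtained from $T$ by replacing one vertex $v_m$ by $q_{j+1}$ ($m=0,\dots,d$), and $B_{j+1}=(q_0,\dots,q_{j+1})$. The embedding $\phi_t:S\to\mathbb R^{t+1}$ is defined as follows: if $\vec x$ lies in a simplex $T\in\mathcal T_t$ with vertices $q_{i_0},\dots,q_{i_d}$ and $\vec x=\sum_{m=0}^d\alpha_m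 q_{i_m}$ with $\alpha_m\ge 0$, $\sum_m\alpha_m=1$ (barycentric coordinates), then $\phi_t(\vec x)_{i_m}=\alpha_m$ for $m=0,\dots,d$ and all other coordinates of $\phi_t(\vec x)$ are $0$ (this is independent of the choice of $T$ when $\vec x$ lies on a common face). Weights may equal $-\infty$, with the conventions $(-\infty)\cdot 0=0$ and $(-\infty)\cdot a=-\infty$ for $a>0$, and sums containing $-\infty$ (and otherwise finite terms) equal to $-\infty$. For $X\subseteq\mathbb R^d$ and $\varepsilon>0$, $X^{(-\varepsilon)}=\{p\in X: B_\varepsilon(p)\subseteq X\}$, where $B_\varepsilon(p)$ is the closed Euclidean ball of radius $\varepsilon$ around $p$. $\operatorname{vol}$ is $d$-dimensional Lebesgue measure. The barycenter of a simplex with vertices $p_0,\dots,p_d$ is $(p_0+\dots+p_d)/(d+1)$. *)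

(* Defs.v *)
(* real numbers from Stdlib Reals.
   Points of R^d are represented as functions  nat -> R  whose coordinates
   with index >= d vanish (predicate [inRd d]); only coordinates 0..d-1 matter. *)
From Stdlib Require Import Reals List.
Open Scope R_scope.

Fixpoint sumR (n : nat) (f : nat -> R) : R :=
  match n with O => 0 | S n' => sumR n' f + f n' end.
Fixpoint prodR (n : nat) (f : nat -> R) : R :=
  match n with O => 1 | S n' => prodR n' f * f n' end.

Definition point := nat -> R.

Definition inRd (d : nat) (x : point) : Prop := forall i, (d <= i)%nat -> x i = 0.

Definition dist (d : nat) (x y : point) : R :=
  sqrt (sumR d (fun i => (x i - y i) ^ 2)).

Definition ball (d : nat) (p : point) (eps : R) (y : point) : Prop :=
  inRd d y /\ dist d p y <= eps.

Definition shrink (d : nat) (X : point -> Prop) (eps : R) (p : point) : Prop :=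
  X p /\ forall y, ball d p eps y -> X y.

Definition simplex_hull (d : nat) (v : nat -> point) (x : point) : Prop :=
  inRd d x /\
  exists lam : nat -> R,
    (forall j, (j <= d)%nat -> 0 <= lam j) /\ sumR (S d) lam = 1 /\
    forall i, (i < d)%nat -> x i = sumR (S d) (fun j => lam j * v j i).

Definition regular_unit_simplex (d : nat) (v : nat -> point) : Prop :=
  (forall j, (j <= d)%nat -> inRd d (v j)) /\
  (forall j k, (j <= d)%nat -> (k <= d)%nat -> j <> k -> dist d (v j) (v k) = 1).

Definition convex_set (d : nat) (P : point -> Prop) : Prop :=
  forall x y lam, P x -> P y -> 0 <= lam <= 1 ->
    P (fun i => lam * x i + (1 - lam) * y i).
Definition closed_set (d : nat) (P : point -> Prop) : Prop :=
  forall x, inRd d x -> (forall delta, 0 < delta -> exists y, P y /\ dist d x y < delta) -> P x.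
Definition bounded_set (d : nat) (P : point -> Prop) : Prop :=
  exists M, forall x y, P x -> P y -> dist d x y <= M.
Definition convex_body (d : nat) (P : point -> Prop) : Prop :=
  (forall x, P x -> inRd d x) /\ convex_set d P /\ closed_set d P /\ bounded_set d P /\
  exists x r, 0 < r /\ forall y, ball d x r y -> P y.

Definition diameter_one (d : nat) (P : point -> Prop) : Prop :=
  (forall x y, P x -> P y -> dist d x y <= 1) /\
  (forall delta, 0 < delta -> exists x y, P x /\ P y /\ 1 - delta < dist d x y).

Definition box_cover (d : nat) (X : point -> Prop) (a b : nat -> point) (L : R) : Prop :=
  (forall k i, a k i <= b k i) /\
  (forall x, X x -> exists k, forall i, (i < d)%nat -> a k i <= x i <= b k i) /\
  infinite_sum (fun k => prodR d (fun i => b k i - a k i)) L.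

Definition is_glb (E : R -> Prop) (m : R) : Prop :=
  (forall L, E L -> m <= L) /\ (forall c, (forall L, E L -> c <= L) -> c <= m).

Definition is_volume (d : nat) (X : point -> Prop) (m : R) : Prop :=
  is_glb (fun L => exists a b, box_cover d X a b L) m.

Definition volume_lt (d : nat) (X : point -> Prop) (c : R) : Prop :=
  exists a b L, box_cover d X a b L /\ L < c.

(* a simplex of a triangulation is a list of d+1 indices into the point sequence q *)
Fixpoint replace_nth (s : list nat) (m : nat) (x : nat) : list nat :=
  match s, m with
  | nil, _ => nil
  | _ :: s', O => x :: s'
  | y :: s', S m' => y :: replace_nth s' m' x
  end.

Definition barycenter (q : nat -> point) (s : list nat) : point :=
  fun i => fold_right (fun j acc => q j i + acc) 0 s / INR (length s).

Inductive barycentric_nbs (d : nat) (q : nat -> point) : nat -> list (list nat) -> Prop :=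
| nbs_base : barycentric_nbs d q d (seq 0 (S d) :: nil)
| nbs_step : forall t T1 s T2,
    barycentric_nbs d q t (T1 ++ s :: T2) ->
    q (S t) = barycenter q s ->
    barycentric_nbs d q (S t)
      (T1 ++ map (fun m => replace_nth s m (S t)) (seq 0 (length s)) ++ T2).

Definition is_phi (d : nat) (q : nat -> point) (t : nat) (T : list (list nat))
    (x : point) (alpha : nat -> R) : Prop :=
  exists s, In s T /\
    (forall j, ~ In j s -> alpha j = 0) /\
    (forall j, 0 <= alpha j) /\
    sumR (S t) alpha = 1 /\
    forall i, (i < d)%nat -> x i = sumR (S t) (fun j => alpha j * q j i).

(* weights in R u {-oo}: None = -oo.  w . alpha >= 0 with (-oo)*0 = 0,
   (-oo)*a = -oo for a > 0, and sums containing -oo equal -oo *)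
Definition wdot_nonneg (t : nat) (w : nat -> option R) (alpha : nat -> R) : Prop :=
  (forall j, (j <= t)%nat -> 0 < alpha j -> w j <> None) /\
  0 <= sumR (S t) (fun j => match w j with Some r => r * alpha j | None => 0 end).

Definition tildeP (d : nat) (v : nat -> point) (q : nat -> point) (t : nat)
    (T : list (list nat)) (w : nat -> option R) (x : point) : Prop :=
  simplex_hull d v x /\
  exists alpha, is_phi d q t T x alpha /\ wdot_nonneg t w alpha.

(* Main.v *)
(* Split every simplex at its barycenter n times, then once more, giving the center of a
   simplex of the n-th triangulation weight 0 if the simplex meets P and -oo otherwise (all
   older vertices have weight 0). Up to facets, the resulting set is the union of the simplices
   meeting P, and its part outside P lies in the "mixed" simplices, which meet both P and its
   complement. Long thin simplices never disappear, but this does no harm: by an affine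
   invariant argument every simplex has, a bounded number K of generations later, a descendant
   that is contained in P or disjoint from P. As the descendants of one generation have equal
   volumes, the volume of the mixed simplices decays like (1 - (d+1)^-K)^(n/K). Finally, a point
   outside P whose eps-ball lies in the approximating set would provide a cube of fixed size in
   the difference, so a small enough difference excludes this. *)
From Stdlib Require Import ZArith Reals List Lra Lia Classical ClassicalEpsilon
  IndefiniteDescription FunctionalExtensionality Arith.
Require Import Defs.
Open Scope R_scope.

(** * Box covers of a cube *)

(** Volume enters only through two one-sided estimates: upper bounds by finite box covers
    ([content_le]), and the fact that countably many boxes covering a cube have total volume at
    least that of the cube. The factor 1/(d+1) per split comes without determinants: in barycentric
    coordinates, passing from a child to its parent is a fixed affine map, the same for all
    simplices, and it is essentially a shear combined with one scaling. The additional round of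
    splits is forced by shared vertices: a weight -oo at an old vertex would remove every simplex
    around it, whereas a fresh center belongs only to the children of its own simplex. The price is
    that the facets of a removed simplex survive, since the center has coordinate 0 there; hence
    facets need content zero. For d at least 2 the edges of S are never cut, so diameters cannot be
    used to show that few simplices are mixed. The substitute compares the values of a linear form
    with its range on the vertices; these ratios do not see the shape of the simplex, which makes K
    uniform. *)

Lemma sumR_ext (n : nat) (f g : nat -> R) :
  (forall i, (i < n)%nat -> f i = g i) -> sumR n f = sumR n g.
Proof.
  induction n as [|n IH]; intros H; simpl; [reflexivity|].
  rewrite IH, H; auto.
Qed.

Lemma sumR_plus (n : nat) (f g : nat -> R) :
  sumR n (fun i => f i + g i) = sumR n f + sumR n g.
Proof. induction n as [|n IH]; simpl; [ring|rewrite IH; ring]. Qed.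

Lemma sumR_scal (n : nat) (c : R) (f : nat -> R) :
  sumR n (fun i => c * f i) = c * sumR n f.
Proof. induction n as [|n IH]; simpl; [ring|rewrite IH; ring]. Qed.

Lemma sumR_const (n : nat) (c : R) : sumR n (fun _ => c) = INR n * c.
Proof. induction n as [|n IH]; [simpl; ring|]. rewrite S_INR; simpl; rewrite IH; ring. Qed.

Lemma sumR_le (n : nat) (f g : nat -> R) :
  (forall i, (i < n)%nat -> f i <= g i) -> sumR n f <= sumR n g.
Proof.
  induction n as [|n IH]; intros H; simpl; [lra|].
  apply Rplus_le_compat; auto.
Qed.

Lemma sumR_nonneg (n : nat) (f : nat -> R) :
  (forall i, (i < n)%nat -> 0 <= f i) -> 0 <= sumR n f.
Proof.
  intros H; replace 0 with (sumR n (fun _ => 0)) by (rewrite sumR_const; ring).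
  now apply sumR_le.
Qed.

Lemma sumR_le_term (n : nat) (f : nat -> R) (k : nat) :
  (forall i, (i < n)%nat -> 0 <= f i) -> (k < n)%nat -> f k <= sumR n f.
Proof.
  induction n as [|n IH]; intros H Hk; [lia|]; simpl.
  assert (0 <= f n) by auto.
  assert (0 <= sumR n f) by (apply sumR_nonneg; auto).
  destruct (Nat.eq_dec k n) as [->|Hn]; [lra|].
  assert (f k <= sumR n f) by (apply IH; auto; lia); lra.
Qed.

Lemma sumR_abs (n : nat) (f : nat -> R) :
  Rabs (sumR n f) <= sumR n (fun i => Rabs (f i)).
Proof.
  induction n as [|n IH]; simpl; [rewrite Rabs_R0; lra|].
  eapply Rle_trans; [apply Rabs_triang|lra].
Qed.

Lemma sumR_swap (n m : nat) (f : nat -> nat -> R) :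
  sumR n (fun i => sumR m (fun j => f i j)) = sumR m (fun j => sumR n (fun i => f i j)).
Proof.
  induction n as [|n IH]; simpl; [rewrite sumR_const; ring|].
  now rewrite IH, sumR_plus.
Qed.

Lemma sumR_single (n k : nat) (f : nat -> R) : (k < n)%nat ->
  sumR n (fun i => if Nat.eqb i k then f i else 0) = f k.
Proof.
  induction n as [|n IH]; intros Hk; [lia|]; simpl.
  destruct (Nat.eqb_spec n k) as [->|Hn].
  - rewrite (sumR_ext k _ (fun _ => 0)); [rewrite sumR_const; ring|].
    intros i Hi; destruct (Nat.eqb_spec i k); [lia|reflexivity].
  - rewrite IH by lia; ring.
Qed.

Lemma sumR_remove (n k : nat) (f : nat -> R) : (k < n)%nat ->
  sumR n (fun i => if Nat.eqb i k then 0 else f i) = sumR n f - f k.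
Proof.
  intros Hk; rewrite <- (sumR_single n k f Hk).
  enough (sumR n f = sumR n (fun i => if Nat.eqb i k then 0 else f i) +
                     sumR n (fun i => if Nat.eqb i k then f i else 0)) by lra.
  rewrite <- sumR_plus; apply sumR_ext; intros i _; destruct (Nat.eqb i k); ring.
Qed.

Lemma prodR_ext (n : nat) (f g : nat -> R) :
  (forall i, (i < n)%nat -> f i = g i) -> prodR n f = prodR n g.
Proof.
  induction n as [|n IH]; intros H; simpl; [reflexivity|].
  rewrite IH, H; auto.
Qed.

Lemma prodR_const (n : nat) (c : R) : prodR n (fun _ => c) = c ^ n.
Proof. induction n as [|n IH]; simpl; [ring|rewrite IH; ring]. Qed.

Lemma prodR_mult (n : nat) (f g : nat -> R) :
  prodR n (fun i => f i * g i) = prodR n f * prodR n g.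
Proof. induction n as [|n IH]; simpl; [ring|rewrite IH; ring]. Qed.

Lemma prodR_nonneg (n : nat) (f : nat -> R) :
  (forall i, (i < n)%nat -> 0 <= f i) -> 0 <= prodR n f.
Proof.
  induction n as [|n IH]; intros H; simpl; [lra|].
  apply Rmult_le_pos; auto.
Qed.

Lemma prodR_le (n : nat) (f g : nat -> R) :
  (forall i, (i < n)%nat -> 0 <= f i <= g i) -> prodR n f <= prodR n g.
Proof.
  induction n as [|n IH]; intros H; simpl; [lra|].
  apply Rmult_le_compat; [|apply H; lia|auto|apply H; lia].
  apply prodR_nonneg; intros i Hi; apply H; lia.
Qed.

Lemma prodR_single_add (n k : nat) (f g h : nat -> R) : (k < n)%nat ->
  f k = g k + h k ->
  (forall i, (i < n)%nat -> i <> k -> g i = f i /\ h i = f i) ->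
  prodR n f = prodR n g + prodR n h.
Proof.
  induction n as [|n IH]; intros Hk Hf H; [lia|]; simpl.
  destruct (Nat.eq_dec k n) as [->|Hn].
  - rewrite (prodR_ext n g f), (prodR_ext n h f), Hf; [ring| |];
      intros i Hi; apply H; lia.
  - destruct (H n) as [-> ->]; [lia|lia|].
    rewrite IH; [ring|lia|exact Hf|intros i Hi; apply H; lia].
Qed.

Lemma prodR_right_cont (n : nat) (f c : nat -> R) :
  (forall i, (i < n)%nat -> 0 <= f i /\ 0 <= c i) ->
  forall eta, 0 < eta -> exists rho0, 0 < rho0 /\
    forall rho, 0 < rho <= rho0 ->
      prodR n (fun i => f i + c i * rho) <= prodR n f + eta.
Proof.
  induction n as [|n IH]; intros H eta Heta.
  - exists 1; split; [lra|]; intros; simpl; lra.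
  - destruct (H n) as [Hf Hc]; [lia|].
    assert (Hp : 0 <= prodR n f) by (apply prodR_nonneg; intros; apply H; lia).
    set (e1 := eta / (2 * (f n + c n + 1))).
    assert (He1 : 0 < e1) by (apply Rdiv_lt_0_compat; lra).
    destruct (IH (fun i Hi => H i (Nat.lt_trans _ _ _ Hi (Nat.lt_succ_diag_r n))) e1 He1)
      as [r1 [Hr1 IH1]].
    set (r2 := eta / (2 * (c n * prodR n f + 1))).
    assert (Hq : 0 <= c n * prodR n f) by (apply Rmult_le_pos; lra).
    assert (Hr2 : 0 < r2) by (apply Rdiv_lt_0_compat; lra).
    exists (Rmin 1 (Rmin r1 r2)); split; [repeat apply Rmin_glb_lt; lra|].
    intros rho [Hrho Hle]; simpl.
    assert (rho <= 1 /\ rho <= r1 /\ rho <= r2) as [Hl0 [Hl1 Hl2]].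
    { generalize (Rmin_l 1 (Rmin r1 r2)) (Rmin_r 1 (Rmin r1 r2)) (Rmin_l r1 r2) (Rmin_r r1 r2).
      lra. }
    specialize (IH1 rho (conj Hrho Hl1)).
    assert (Hcr : 0 <= c n * rho <= c n) by (split; nra).
    apply Rle_trans with ((prodR n f + e1) * (f n + c n * rho)).
    { apply Rmult_le_compat_r; lra. }
    assert (E1 : e1 * (f n + c n + 1) = eta / 2) by (unfold e1; field; lra).
    assert (E2 : r2 * (c n * prodR n f + 1) = eta / 2) by (unfold r2; field; lra).
    assert (e1 * (f n + c n * rho) <= eta / 2) by (rewrite <- E1; apply Rmult_le_compat_l; lra).
    assert (prodR n f * (c n * rho) <= eta / 2).
    { rewrite <- E2. apply Rle_trans with (r2 * (c n * prodR n f)); [|nra].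
      replace (prodR n f * (c n * rho)) with (rho * (c n * prodR n f)) by ring.
      apply Rmult_le_compat_r; lra. }
    nra.
Qed.

(** * Bisecting a cube against a sequence of boxes *)

Definition overlap (a b p q : R) : R := Rmax 0 (Rmin b q - Rmax a p).

Lemma overlap_nonneg (a b p q : R) : 0 <= overlap a b p q.
Proof. apply Rmax_l. Qed.

Ltac overlap_cases :=
  unfold overlap, Rmax, Rmin; repeat destruct Rle_dec; lra.

Lemma overlap_le (a b p q : R) : a <= b -> overlap a b p q <= b - a.
Proof. intros; overlap_cases. Qed.

Lemma overlap_inside (a b p q : R) : a <= p -> q <= b -> p <= q -> overlap a b p q = q - p.
Proof. intros; overlap_cases. Qed.

Lemma overlap_split (a b p m q : R) : a <= b -> p <= m -> m <= q ->
  overlap a b p q = overlap a b p m + overlap a b m q.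
Proof. intros; overlap_cases. Qed.

Section Bisection.

Variables (d : nat) (a b : nat -> point) (theta : R).
Hypothesis a_le_b : forall k i, a k i <= b k i.

Definition covered_volume (N : nat) (p s : point) : R :=
  sumR N (fun k => prodR d (fun i => overlap (a k i) (b k i) (p i) (p i + s i))).

(** Bounding all finite partial sums avoids any question of convergence for the overlaps, and a
    failure is witnessed by one finite N. *)
Definition sparse (p s : point) : Prop :=
  forall N, covered_volume N p s <= theta * prodR d s.

Lemma covered_volume_mono (N M : nat) (p s : point) :
  (N <= M)%nat -> covered_volume N p s <= covered_volume M p s.
Proof.
  induction 1 as [|M _ IH]; [lra|].
  eapply Rle_trans; [exact IH|]; unfold covered_volume; simpl.
  assert (0 <= prodR d (fun i => overlap (a M i) (b M i) (p i) (p i + s i))); [|lra].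
  apply prodR_nonneg; intros; apply overlap_nonneg.
Qed.

(** Pigeonhole: if both halves exceeded the proportion [theta], each would do so after finitely many
    boxes, and at the larger of the two indices the covered volumes would add up to more than
    [theta] times the whole. *)
Lemma sparse_halve_coordinate (k : nat) (p s : point) : (k < d)%nat ->
  (forall i, 0 <= s i) -> sparse p s ->
  let s' := fun i => if Nat.eqb i k then s i / 2 else s i in
  exists p', sparse p' s' /\ forall i, p i <= p' i <= p i + (s i - s' i).
Proof.
  intros Hk Hs Hsp s'.
  set (p' := fun i => if Nat.eqb i k then p i + s i / 2 else p i).
  assert (Hs' : forall i, 0 <= s i - s' i).
  { intros i; unfold s'; specialize (Hs i); destruct (Nat.eqb i k); lra. }
  destruct (classic (sparse p s')) as [H|H].
  { exists p; split; [exact H|]; intros i; specialize (Hs' i); lra. }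
  exists p'; split.
  2: { intros i; unfold p', s'; specialize (Hs i); destruct (Nat.eqb i k); lra. }
  apply not_all_ex_not in H; destruct H as [N1 H1].
  intros N2; apply Rnot_lt_le; intros H2.
  set (N := Nat.max N1 N2).
  assert (K1 : covered_volume N1 p s' <= covered_volume N p s') by (apply covered_volume_mono; lia).
  assert (K2 : covered_volume N2 p' s' <= covered_volume N p' s') by (apply covered_volume_mono; lia).
  assert (K : covered_volume N p s = covered_volume N p s' + covered_volume N p' s').
  { unfold covered_volume; rewrite <- sumR_plus; apply sumR_ext; intros j _.
    apply (prodR_single_add d k); [exact Hk| |].
    - unfold s', p'; rewrite Nat.eqb_refl; specialize (Hs k).
      rewrite (overlap_split _ _ _ (p k + s k / 2)); [|apply a_le_b|lra|lra].
      f_equal; f_equal; lra.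
    - intros i _ Hi; unfold s', p'; destruct (Nat.eqb_spec i k); [lia|auto]. }
  assert (V : prodR d s = prodR d s' + prodR d s').
  { apply (prodR_single_add d k); [exact Hk| |].
    - unfold s'; rewrite Nat.eqb_refl; field.
    - intros i _ Hi; unfold s'; destruct (Nat.eqb_spec i k); [lia|auto]. }
  specialize (Hsp N); rewrite K, V in Hsp; lra.
Qed.

Lemma sparse_halve_coordinates (n : nat) (p s : point) : (n <= d)%nat ->
  (forall i, 0 <= s i) -> sparse p s ->
  let s' := fun i => if Nat.ltb i n then s i / 2 else s i in
  exists p', sparse p' s' /\ forall i, p i <= p' i <= p i + (s i - s' i).
Proof.
  induction n as [|n IH]; intros Hn Hs Hsp s'.
  - exists p; split; [exact Hsp|]; intros i; unfold s'; simpl; lra.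
  - destruct IH as [p1 [Hp1 Hb1]]; [lia|exact Hs|exact Hsp|].
    destruct (sparse_halve_coordinate n p1 (fun i => if Nat.ltb i n then s i / 2 else s i))
      as [p2 [Hp2 Hb2]]; [lia| |exact Hp1|].
    { intros i; specialize (Hs i); destruct (Nat.ltb i n); lra. }
    replace s' with (fun i => if Nat.eqb i n then (if Nat.ltb i n then s i / 2 else s i) / 2
                              else if Nat.ltb i n then s i / 2 else s i).
    + exists p2; split; [exact Hp2|].
      intros i; specialize (Hb1 i); specialize (Hb2 i); lra.
    + apply functional_extensionality; intros i; unfold s'.
      destruct (Nat.eqb_spec i n), (Nat.ltb_spec i n), (Nat.ltb_spec i (S n));
        try lia; reflexivity.
Qed.

Lemma sparse_halve_cube (p : point) (h : R) : 0 <= h -> sparse p (fun _ => h) ->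
  exists p', sparse p' (fun _ => h / 2) /\ forall i, (i < d)%nat -> p i <= p' i <= p i + h / 2.
Proof.
  intros Hh Hsp.
  destruct (sparse_halve_coordinates d p (fun _ => h)) as [p' [Hp Hb]]; auto.
  exists p'; split.
  - intros N; specialize (Hp N); unfold covered_volume in *.
    rewrite (prodR_ext d (fun _ => h / 2) (fun i => if Nat.ltb i d then h / 2 else h)).
    + eapply Rle_trans; [apply Req_le|exact Hp].
      apply sumR_ext; intros k _; apply prodR_ext; intros i Hi.
      destruct (Nat.ltb_spec i d); [reflexivity|lia].
    + intros i Hi; destruct (Nat.ltb_spec i d); [reflexivity|lia].
  - intros i Hi; specialize (Hb i); cbv beta in Hb.
    destruct (Nat.ltb_spec i d); [lra|lia].
Qed.

Lemma sparse_cube_limit (p : point) (h : R) : 0 < h -> sparse p (fun _ => h) ->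
  exists x, inRd d x /\ (forall i, (i < d)%nat -> p i <= x i <= p i + h) /\
    forall n, exists p', sparse p' (fun _ => h / 2 ^ n) /\
      forall i, (i < d)%nat -> p' i <= x i <= p' i + h / 2 ^ n.
Proof.
  intros Hh Hsp.
  (* The choice is made on pairs of a corner and a depth so that it can be iterated; corners of
     cubes that are not sparse get a dummy successor. *)
  destruct (functional_choice (fun (pn : point * nat) p' =>
    sparse (fst pn) (fun _ => h / 2 ^ snd pn) ->
    sparse p' (fun _ => h / 2 ^ (S (snd pn))) /\
    forall i, (i < d)%nat -> fst pn i <= p' i <= fst pn i + h / 2 ^ (S (snd pn)))) as [next Hnext].
  { intros [p0 n]; simpl fst; simpl snd.
    destruct (classic (sparse p0 (fun _ => h / 2 ^ n))) as [H|H]; [|exists p0; tauto].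
    assert (0 < 2 ^ n) by (apply pow_lt; lra).
    destruct (sparse_halve_cube p0 (h / 2 ^ n)) as [p' Hp'].
    - apply Rlt_le, Rdiv_lt_0_compat; lra.
    - exact H.
    - exists p'; intros _.
      replace (h / 2 ^ S n) with (h / 2 ^ n / 2) by (simpl; field; lra).
      exact Hp'. }
  set (P := fix P n := match n with O => p | S n' => next (P n', n') end).
  assert (HP : forall n, sparse (P n) (fun _ => h / 2 ^ n)).
  { induction n as [|n IH]; simpl P.
    - replace (h / 2 ^ 0) with h by (simpl; field); exact Hsp.
    - apply (Hnext (P n, n)); exact IH. }
  assert (Hstep : forall n i, (i < d)%nat -> P n i <= P (S n) i /\
    P (S n) i + h / 2 ^ (S n) <= P n i + h / 2 ^ n).
  { intros n i Hi; destruct (Hnext (P n, n) (HP n)) as [_ H].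
    specialize (H i Hi); simpl fst in H; simpl snd in H; simpl P.
    assert (0 < 2 ^ n) by (apply pow_lt; lra).
    replace (h / 2 ^ n) with (h / 2 ^ S n + h / 2 ^ S n) by (simpl; field; lra).
    lra. }
  assert (Hmono : forall n k i, (i < d)%nat -> P n i <= P (n + k)%nat i /\
    P (n + k)%nat i + h / 2 ^ (n + k) <= P n i + h / 2 ^ n).
  { intros n k i Hi; induction k as [|k IH]; [rewrite Nat.add_0_r; lra|].
    rewrite Nat.add_succ_r; specialize (Hstep (n + k)%nat i Hi); lra. }
  assert (Hpos : forall n, 0 < h / 2 ^ n).
  { intros n; apply Rdiv_lt_0_compat; [lra|apply pow_lt; lra]. }
  assert (Hcross : forall n m i, (i < d)%nat -> P m i <= P n i + h / 2 ^ n).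
  { intros n m i Hi; destruct (Nat.le_ge_cases n m) as [L|L];
      [destruct (Hmono n (m - n)%nat i Hi)|destruct (Hmono m (n - m)%nat i Hi)];
      [replace (n + (m - n))%nat with m in * by lia|replace (m + (n - m))%nat with n in * by lia];
      pose proof (Hpos m); pose proof (Hpos n); lra. }
  destruct (functional_choice (fun i xi => ((d <= i)%nat -> xi = 0) /\
     ((i < d)%nat -> forall n, P n i <= xi <= P n i + h / 2 ^ n))) as [x Hx].
  { intros i; destruct (le_lt_dec d i) as [Hi|Hi]; [exists 0; split; [auto|lia]|].
    destruct (completeness (fun y => exists n, y = P n i)) as [y [Hy1 Hy2]].
    - exists (P O i + h / 2 ^ 0); intros y [n ->]; apply Hcross; exact Hi.
    - exists (P O i); exists O; reflexivity.
    - exists y; split; [lia|]; intros _ n; split.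
      + apply Hy1; exists n; reflexivity.
      + apply Hy2; intros z [m ->]; apply Hcross; exact Hi. }
  exists x; split; [|split].
  - intros i Hi; apply Hx; exact Hi.
  - intros i Hi; destruct (Hx i) as [_ H]; specialize (H Hi O).
    replace (h / 2 ^ 0) with h in H by (simpl; field); exact H.
  - intros n; exists (P n); split; [apply HP|].
    intros i Hi; apply Hx; exact Hi.
Qed.

End Bisection.

Lemma sumR_half_pow (n : nat) : sumR n (fun k => (/ 2) ^ S k) <= 1.
Proof.
  enough (sumR n (fun k => (/ 2) ^ S k) = 1 - (/ 2) ^ n).
  { assert (0 < (/ 2) ^ n) by (apply pow_lt; lra); lra. }
  induction n as [|n IH]; [simpl; ring|].
  change (sumR n (fun k => (/ 2) ^ S k) + (/ 2) ^ S n = 1 - (/ 2) ^ S n).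
  rewrite IH; simpl; lra.
Qed.

Lemma sumR_le_infinite_sum (f : nat -> R) (L : R) (N : nat) :
  (forall k, 0 <= f k) -> infinite_sum f L -> sumR N f <= L.
Proof.
  intros Hf HL.
  assert (E : forall n, sumR (S n) f = sum_f_R0 f n).
  { induction n as [|n IH]; [simpl; ring|]. simpl sum_f_R0; rewrite <- IH; reflexivity. }
  apply Rle_trans with (sumR (S N) f).
  - simpl; specialize (Hf N); lra.
  - rewrite E; apply sum_incr; [exact HL|exact Hf].
Qed.

(* Bisect the cube, always keeping a half that the boxes, fattened to have the points of
   the original boxes in their interior, fill by a proportion at most theta < 1; a fattened
   box around the limit point fills small cubes completely. *)
Lemma box_cover_cube (d : nat) (X : point -> Prop) (a b : nat -> point) (L : R)
    (p : point) (h : R) :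
  box_cover d X a b L -> 0 < h ->
  (forall x, inRd d x -> (forall i, (i < d)%nat -> p i <= x i <= p i + h) -> X x) ->
  h ^ d <= L.
Proof.
  intros [Hab [Hcov Hsum]] Hh HX; apply Rnot_lt_le; intros HL.
  set (eta := (h ^ d - L) / 2).
  assert (Heta : 0 < eta) by (unfold eta; lra).
  (* Fattening box k costs at most eta / 2^(k+1), hence at most eta in total, which is half of the
     assumed deficit h^d - L. *)
  destruct (functional_choice (fun k rho => 0 < rho /\
     prodR d (fun i => (b k i - a k i) + 2 * rho) <=
     prodR d (fun i => b k i - a k i) + eta * (/ 2) ^ S k)) as [rho Hrho].
  { intros k.
    destruct (prodR_right_cont d (fun i => b k i - a k i) (fun _ => 2)) with (eta := eta * (/ 2) ^ S k)
      as [r [Hr H]].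
    - intros i _; specialize (Hab k i); lra.
    - apply Rmult_lt_0_compat; [lra|apply pow_lt; lra].
    - exists r; split; [exact Hr|apply H; lra]. }
  set (a' := fun k i => a k i - rho k); set (b' := fun k i => b k i + rho k).
  assert (Hab' : forall k i, a' k i <= b' k i).
  { intros k i; unfold a', b'; destruct (Hrho k); specialize (Hab k i); lra. }
  assert (Hhd : 0 < h ^ d) by (apply pow_lt; lra).
  set (theta := (L + eta) / h ^ d).
  assert (Hth : theta < 1).
  { unfold theta; apply Rmult_lt_reg_r with (h ^ d); [lra|].
    unfold Rdiv; rewrite Rmult_assoc, Rinv_l by lra; unfold eta; lra. }
  destruct (sparse_cube_limit d a' b' theta Hab' p h Hh) as [x [Hx0 [Hxp Hx]]].
  { intros N; rewrite prodR_const.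
    replace (theta * h ^ d) with (L + eta) by (unfold theta; field; lra).
    apply Rle_trans with (sumR N (fun k => prodR d (fun i => b k i - a k i) + eta * (/ 2) ^ S k)).
    - apply sumR_le; intros k _; eapply Rle_trans; [|apply (Hrho k)].
      apply prodR_le; intros i _; split; [apply overlap_nonneg|].
      eapply Rle_trans; [apply overlap_le, Hab'|unfold a', b'; lra].
    - rewrite sumR_plus, sumR_scal.
      assert (eta * sumR N (fun k => (/ 2) ^ S k) <= eta).
      { generalize (sumR_half_pow N); nra. }
      assert (sumR N (fun k => prodR d (fun i => b k i - a k i)) <= L).
      { apply sumR_le_infinite_sum; [|exact Hsum].
        intros k; apply prodR_nonneg; intros i _; specialize (Hab k i); lra. }
      lra. }
  destruct (Hcov x (HX x Hx0 Hxp)) as [k Hk].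
  destruct (Hrho k) as [Hrk _].
  destruct (pow_lt_1_zero (/ 2)) with (y := rho k / h) as [n Hn].
  { rewrite Rabs_right; lra. }
  { apply Rdiv_lt_0_compat; lra. }
  specialize (Hn n (Nat.le_refl n)).
  destruct (Hx n) as [p' [Hsp Hp']].
  assert (H2n : 0 < 2 ^ n) by (apply pow_lt; lra).
  assert (Hs : 0 < h / 2 ^ n) by (apply Rdiv_lt_0_compat; lra).
  assert (Hsmall : h / 2 ^ n < rho k).
  { rewrite Rabs_right in Hn by (apply Rle_ge, pow_le; lra).
    rewrite pow_inv in Hn.
    apply Rmult_lt_compat_l with (r := h) in Hn; [|lra].
    replace (h * (rho k / h)) with (rho k) in Hn by (field; lra); exact Hn. }
  specialize (Hsp (S k)); rewrite prodR_const in Hsp.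
  assert (Hv : 0 < (h / 2 ^ n) ^ d) by (apply pow_lt; lra).
  assert (Hfull : (h / 2 ^ n) ^ d <= covered_volume d a' b' (S k) p' (fun _ => h / 2 ^ n)).
  { unfold covered_volume.
    eapply Rle_trans; [|apply (sumR_le_term (S k)) with (k := k); [|lia]].
    - cbv beta; rewrite <- prodR_const; apply Req_le, prodR_ext; intros i Hi.
      specialize (Hk i Hi); specialize (Hp' i Hi).
      rewrite overlap_inside; unfold a', b'; lra.
    - intros j _; apply prodR_nonneg; intros; apply overlap_nonneg. }
  nra.
Qed.

(** * Outer content and barycentric splits *)

Definition box_volume (d : nat) (b : point * point) : R := prodR d (fun i => 2 * snd b i).

Definition total_volume (d : nat) (l : list (point * point)) : R :=
  fold_right (fun b acc => box_volume d b + acc) 0 l.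

(* A box is given by its center and its half side lengths. *)
Definition in_box (d : nat) (b : point * point) (x : point) : Prop :=
  forall i, (i < d)%nat -> Rabs (x i - fst b i) <= snd b i.

Definition box_list_cover (d : nat) (l : list (point * point)) (X : point -> Prop) : Prop :=
  (forall b, In b l -> forall i, 0 <= snd b i) /\
  (forall x, X x -> exists b, In b l /\ in_box d b x).

(** An upper bound for outer Jordan content, phrased with a slack [eta] so that no infimum has to be
    formed. Finite lists make unions a concatenation and let images be estimated box by box. *)
Definition content_le (d : nat) (X : point -> Prop) (e : R) : Prop :=
  forall eta, 0 < eta -> exists l, box_list_cover d l X /\ total_volume d l <= e + eta.

Lemma total_volume_app (d : nat) (l1 l2 : list (point * point)) :
  total_volume d (l1 ++ l2) = total_volume d l1 + total_volume d l2.
Proof. induction l1 as [|b l1 IH]; simpl; [ring|rewrite IH; ring]. Qed.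

Lemma content_le_weaken (d : nat) (X Y : point -> Prop) (e e' : R) :
  content_le d X e -> (forall x, Y x -> X x) -> e <= e' -> content_le d Y e'.
Proof.
  intros H HY He eta Heta; destruct (H eta Heta) as [l [[H1 H2] H3]].
  exists l; split; [split; auto|lra].
Qed.

Lemma content_le_empty (d : nat) (X : point -> Prop) :
  (forall x, ~ X x) -> content_le d X 0.
Proof.
  intros H eta Heta; exists nil; split; [split|simpl; lra].
  - intros b [].
  - intros x Hx; destruct (H x Hx).
Qed.

Lemma content_le_union (d : nat) (X Y : point -> Prop) (e e' : R) :
  content_le d X e -> content_le d Y e' -> content_le d (fun x => X x \/ Y x) (e + e').
Proof.
  intros HX HY eta Heta.
  destruct (HX (eta / 2)) as [l [[A1 A2] A3]]; [lra|].
  destruct (HY (eta / 2)) as [l' [[B1 B2] B3]]; [lra|].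
  exists (l ++ l'); split; [split|rewrite total_volume_app; lra].
  - intros b Hb; apply in_app_or in Hb; destruct Hb; auto.
  - intros x [Hx|Hx]; [destruct (A2 x Hx) as [b [Hb Hin]]|destruct (B2 x Hx) as [b [Hb Hin]]];
      exists b; split; auto; apply in_or_app; auto.
Qed.

Lemma content_le_finite_union (d n : nat) (X : nat -> point -> Prop) (e : nat -> R)
    (Y : point -> Prop) :
  (forall k, (k < n)%nat -> content_le d (X k) (e k)) ->
  (forall x, Y x -> exists k, (k < n)%nat /\ X k x) ->
  content_le d Y (sumR n e).
Proof.
  intros HX HY; apply content_le_weaken with (X := fun x => exists k, (k < n)%nat /\ X k x)
    (e := sumR n e); [|exact HY|lra].
  clear Y HY; induction n as [|n IH].
  - apply content_le_empty; intros x [k [Hk _]]; lia.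
  - simpl; eapply content_le_weaken;
      [apply content_le_union; [apply IH; auto|apply (HX n); lia]| |apply Rle_refl].
    intros x [k [Hk Hx]]; destruct (Nat.eq_dec k n) as [->|Hn]; [now right|].
    left; exists k; split; [lia|exact Hx].
Qed.

Lemma segment_slices (h rho : R) : 0 <= h -> 0 < rho ->
  exists N, INR N * (2 * rho) <= 2 * h + 2 * rho /\
    forall c x, Rabs (x - c) <= h ->
      exists i, (i < N)%nat /\ Rabs (x - (c - h + (2 * INR i + 1) * rho)) <= rho.
Proof.
  intros Hh Hrho.
  assert (Hq : 0 <= h / rho) by (apply Rmult_le_pos; [lra|left; apply Rinv_0_lt_compat; lra]).
  destruct (archimed (h / rho)) as [A1 A2].
  assert (Hz : (0 <= up (h / rho))%Z) by (apply le_IZR; simpl; lra).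
  set (N := Z.to_nat (up (h / rho))).
  assert (HN : INR N = IZR (up (h / rho))).
  { unfold N; rewrite INR_IZR_INZ, Z2Nat.id; auto. }
  rewrite <- HN in A1, A2.
  assert (E : h / rho * rho = h) by (field; lra).
  exists N; split; [nra|].
  intros c x Hx; assert (Hb : (0 < N)%nat) by (apply INR_lt; simpl; lra).
  assert (Hx1 : c - h <= x <= c - h + 2 * INR N * rho).
  { revert Hx; unfold Rabs; destruct Rcase_abs; intros; split; nra. }
  clear HN A1 A2 Hx; revert Hb Hx1; generalize N; intros n.
  induction n as [|n IH]; intros Hn Hx; [lia|].
  destruct (Rle_dec (c - h + 2 * INR n * rho) x) as [H|H].
  - exists n; split; [lia|]; rewrite S_INR in Hx; apply Rabs_le; lra.
  - destruct n as [|n]; [simpl in H; lra|].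
    destruct IH as [i [Hi H']]; [lia|lra|]; exists i; split; [lia|exact H'].
Qed.

(** Only the directions in J are cut; n counts the coordinates already treated. The number of slabs
    is bounded in multiplied-out form, ready to be combined with the volume of the image of one
    slab. *)
Lemma box_slices (d : nat) (J : nat -> bool) (c h : point) (rho : R) (n : nat) :
  (forall i, 0 <= h i) -> 0 < rho -> (n <= d)%nat ->
  exists L : list point,
    (forall x, in_box d (c, h) x -> exists c', In c' L /\
       in_box d (c', fun k => if andb (J k) (Nat.ltb k n) then rho else h k) x) /\
    INR (length L) * prodR n (fun k => if J k then 2 * rho else 1) <=
      prodR n (fun k => if J k then 2 * h k + 2 * rho else 1).
Proof.
  intros Hh Hrho; induction n as [|n IH]; intros Hn.
  - exists (c :: nil); split; [|simpl; lra].
    intros x Hx; exists c; split; [now left|].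
    intros i Hi; simpl; rewrite Bool.andb_false_r; apply Hx; exact Hi.
  - destruct IH as [L [HL1 HL2]]; [lia|].
    destruct (J n) eqn:EJ.
    + destruct (segment_slices (h n) rho (Hh n) Hrho) as [N [HN1 HN2]].
      exists (map (fun ci k => if Nat.eqb k n then c n - h n + (2 * INR (snd ci) + 1) * rho
                               else fst ci k) (list_prod L (seq 0 N))).
      split.
      * intros x Hx; destruct (HL1 x Hx) as [c' [Hc' Hin]].
        destruct (HN2 (c n) (x n)) as [i [Hi Hxi]]; [apply (Hx n); lia|].
        eexists; split.
        { apply (in_map _ _ (c', i)), in_prod; [exact Hc'|apply in_seq; lia]. }
        intros k Hk; specialize (Hin k Hk); simpl in *.
        destruct (Nat.eqb_spec k n) as [->|Hkn].
        { rewrite EJ; destruct (Nat.ltb_spec n (S n)); [exact Hxi|lia]. }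
        destruct (Nat.ltb_spec k n), (Nat.ltb_spec k (S n)); try lia; exact Hin.
      * rewrite length_map, length_prod, length_seq, mult_INR; simpl; rewrite EJ.
        assert (0 <= prodR n (fun k => if J k then 2 * rho else 1)).
        { apply prodR_nonneg; intros i _; destruct (J i); lra. }
        generalize (pos_INR N) (pos_INR (length L)); intros.
        replace (INR (length L) * INR N * (prodR n (fun k => if J k then 2 * rho else 1) * (2 * rho)))
          with ((INR (length L) * prodR n (fun k => if J k then 2 * rho else 1)) * (INR N * (2 * rho)))
          by ring.
        apply Rmult_le_compat; [apply Rmult_le_pos|apply Rmult_le_pos| |]; lra.
    + exists L; split; [|simpl; rewrite EJ; lra].
      intros x Hx; destruct (HL1 x Hx) as [c' [Hc' Hin]]; exists c'; split; [exact Hc'|].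
      intros k Hk; specialize (Hin k Hk); simpl in *.
      destruct (Nat.ltb_spec k n), (Nat.ltb_spec k (S n)); try lia; try exact Hin.
      replace k with n in * by lia; rewrite EJ in *; exact Hin.
Qed.

Lemma total_volume_same (d : nat) (F : point -> point) (h : point) (L : list point) :
  total_volume d (map (fun c => (F c, h)) L) = INR (length L) * prodR d (fun i => 2 * h i).
Proof.
  induction L as [|c L IH]; [simpl; ring|].
  simpl length; rewrite S_INR; simpl; rewrite IH; unfold box_volume; simpl; ring.
Qed.

(* Thin slabs in the directions J have thin images in those directions, and the other
   coordinates are moved along by an amount that is negligible on such a slab. *)
Lemma content_le_image (d : nat) (J : nat -> bool) (A : nat -> R) (C : R)
    (F : point -> point) (X Y : point -> Prop) (e : R) :
  (forall k, 0 <= A k) -> 0 <= C ->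
  (forall rho x y, 0 < rho ->
     (forall j, (j < d)%nat -> J j = true -> Rabs (x j - y j) <= rho) ->
     forall k, (k < d)%nat ->
       Rabs (F x k - F y k) <= if J k then A k * rho else A k * Rabs (x k - y k) + C * rho) ->
  content_le d X e ->
  (forall y, Y y -> exists x, X x /\ forall k, (k < d)%nat -> y k = F x k) ->
  content_le d Y (prodR d A * e).
Proof.
  intros HA HC HF HX HY eta Heta.
  assert (HpA : 0 <= prodR d A) by (apply prodR_nonneg; auto).
  assert (Hlist : forall l, (forall b, In b l -> forall i, 0 <= snd b i) ->
    forall eta, 0 < eta -> exists l',
    (forall b, In b l' -> forall i, 0 <= snd b i) /\
    (forall x, (exists b, In b l /\ in_box d b x) -> exists b, In b l' /\ in_box d b (F x)) /\
    total_volume d l' <= prodR d A * total_volume d l + eta).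
  { clear - HA HC HF HpA; induction l as [|[c h] l IH]; intros Hl eta Heta.
    - exists nil; split; [intros b []|]; split; [intros x [b [[] _]]|simpl; lra].
    - destruct IH with (eta := eta / 2) as [l1 [P1 [P2 P3]]];
        [intros; apply Hl; now right|lra|].
      assert (Hh : forall i, 0 <= h i) by (apply (Hl (c, h)); now left).
      destruct (prodR_right_cont d (fun k => A k * (2 * h k)) (fun k => 2 * A k + 2 * C))
        with (eta := eta / 2) as [rho [Hrho Hprod]]; [|lra|].
      { intros i _; specialize (HA i); specialize (Hh i); split; [nra|lra]. }
      specialize (Hprod rho); destruct (box_slices d J c h rho d Hh Hrho) as [L [HL1 HL2]]; [lia|].
      set (h' := fun k => if J k then A k * rho else A k * h k + C * rho).
      exists (map (fun c' => (F c', h')) L ++ l1); split; [|split].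
      + intros b Hb i; apply in_app_or in Hb; destruct Hb as [Hb|Hb]; [|auto].
        apply in_map_iff in Hb; destruct Hb as [c' [<- _]]; simpl; unfold h'.
        specialize (HA i); specialize (Hh i); destruct (J i); nra.
      + intros x [b [[<-|Hb] Hin]].
        * destruct (HL1 x Hin) as [c' [Hc' Hin']].
          exists (F c', h'); split; [apply in_or_app; left; apply in_map_iff; eauto|].
          intros k Hk; simpl; unfold h'.
          eapply Rle_trans; [apply (HF rho); [lra| |exact Hk]|].
          { intros j Hj EJ; specialize (Hin' j Hj); simpl in Hin'; rewrite EJ in Hin'.
            destruct (Nat.ltb_spec j d); [exact Hin'|lia]. }
          specialize (Hin' k Hk); simpl in Hin'; destruct (J k); [lra|].
          simpl in Hin'; specialize (HA k); nra.
        * destruct (P2 x) as [b' [Hb' Hin']]; [eauto|].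
          exists b'; split; [apply in_or_app; now right|exact Hin'].
      + rewrite total_volume_app, total_volume_same; simpl; unfold box_volume at 1; simpl.
        enough (INR (length L) * prodR d (fun i => 2 * h' i) <=
          prodR d (fun k => A k * (2 * h k)) + eta / 2) as H.
        { rewrite (prodR_mult d A) in H; lra. }
        eapply Rle_trans; [|apply Hprod; lra].
        (* [u] is what remains of the side 2 * h' once the slab width 2 * rho is factored out in the
           directions of J; this width is then absorbed by the bound on the number of slabs. *)
        set (u := fun k => if J k then A k else 2 * (A k * h k) + 2 * (C * rho)).
        assert (Hu : forall k, 0 <= u k).
        { intros k; unfold u; specialize (HA k); specialize (Hh k); destruct (J k); nra. }
        rewrite (prodR_ext d _ (fun k => (if J k then 2 * rho else 1) * u k)).
        2: { intros k _; unfold h', u; destruct (J k); ring. }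
        rewrite prodR_mult, <- Rmult_assoc.
        eapply Rle_trans; [apply Rmult_le_compat_r; [apply prodR_nonneg; auto|exact HL2]|].
        rewrite <- prodR_mult; apply prodR_le; intros k _.
        specialize (Hu k); specialize (HA k); specialize (Hh k); unfold u in *.
        assert (0 <= C * rho) by nra; assert (0 <= A k * rho) by nra.
        destruct (J k); split; nra. }
  set (eta1 := eta / (2 * (prodR d A + 1))).
  assert (Heta1 : 0 < eta1) by (apply Rdiv_lt_0_compat; lra).
  destruct (HX eta1 Heta1) as [l [[H1 H2] H3]].
  destruct (Hlist l H1 (eta / 2)) as [l' [P1 [P2 P3]]]; [lra|].
  exists l'; split; [split|].
  - exact P1.
  - intros y Hy; destruct (HY y Hy) as [x [Hx Hyx]].
    destruct (P2 x) as [b [Hb Hin]]; [auto|].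
    exists b; split; [exact Hb|]; intros k Hk; rewrite (Hyx k Hk); auto.
  - assert (E : eta1 * (prodR d A + 1) = eta / 2) by (unfold eta1; field; lra).
    assert (prodR d A * total_volume d l <= prodR d A * (e + eta1))
      by (apply Rmult_le_compat_l; lra).
    nra.
Qed.

(** * Barycentric splits in affine coordinates *)

Definition bary (d : nat) (V : nat -> point) : point :=
  fun i => sumR (S d) (fun j => V j i) / INR (S d).

Definition child (d : nat) (V : nat -> point) (m : nat) : nat -> point :=
  fun j => if Nat.eqb j m then bary d V else V j.

Lemma INR_S_pos (d : nat) : 0 < INR (S d).
Proof. apply lt_0_INR; lia. Qed.

(** The weight that a point puts on the new barycenter is distributed evenly over all d+1 old
    vertices, the replaced one included; this gives its coordinates in the parent. *)
Lemma sumR_child (d m : nat) (V : nat -> point) (al : nat -> R) (i : nat) : (m <= d)%nat ->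
  sumR (S d) (fun j => al j * child d V m j i) =
  sumR (S d) (fun j => ((if Nat.eqb j m then 0 else al j) + al m / INR (S d)) * V j i).
Proof.
  intros Hm; generalize (INR_S_pos d); intros Hd.
  rewrite (sumR_ext (S d) (fun j => ((if Nat.eqb j m then 0 else al j) + al m / INR (S d)) * V j i)
    (fun j => (if Nat.eqb j m then 0 else al j * V j i) + al m / INR (S d) * V j i))
    by (intros j _; destruct (Nat.eqb j m); ring).
  rewrite (sumR_ext (S d) (fun j => al j * child d V m j i)
    (fun j => (if Nat.eqb j m then 0 else al j * V j i) +
              (if Nat.eqb j m then al m * bary d V i else 0))).
  2: { intros j _; unfold child; destruct (Nat.eqb_spec j m) as [->|]; ring. }
  rewrite !sumR_plus, sumR_scal.
  rewrite (sumR_single (S d) m (fun _ => al m * bary d V i)) by lia.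
  unfold bary; field; lra.
Qed.

Lemma sumR_child_coordinates (d m : nat) (al : nat -> R) : (m <= d)%nat ->
  sumR (S d) (fun j => (if Nat.eqb j m then 0 else al j) + al m / INR (S d)) = sumR (S d) al.
Proof.
  intros Hm; rewrite sumR_plus, sumR_const, sumR_remove by lia.
  generalize (INR_S_pos d); intros; field; lra.
Qed.

(* Affine coordinates: y in R^d stands for the barycentric coordinates
   (y_0, ..., y_(d-1), 1 - y_0 - ... - y_(d-1)). *)
Definition bary_coord (d : nat) (y : point) (j : nat) : R :=
  if Nat.ltb j d then y j else 1 - sumR d y.

Definition amap (d : nat) (V : nat -> point) (y : point) : point :=
  fun i => sumR (S d) (fun j => bary_coord d y j * V j i).

(** The change of coordinates from a child to its parent. It does not involve the vertices, so one
    estimate serves all simplices. *)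
Definition child_map (d m : nat) (y : point) : point :=
  fun j => (if Nat.eqb j m then 0 else y j) + bary_coord d y m / INR (S d).

(** The exchange of the barycentric coordinates 0 and d. Coordinate d is only implicit, so the split
    at vertex d is reduced to the split at vertex 0 by conjugation with this map. *)
Definition swap_map (d : nat) (y : point) : point :=
  fun j => if Nat.eqb j 0 then 1 - sumR d y else y j.

Lemma bary_coord_lt (d : nat) (y : point) (j : nat) : (j < d)%nat -> bary_coord d y j = y j.
Proof. intros H; unfold bary_coord; destruct (Nat.ltb_spec j d); [reflexivity|lia]. Qed.

Lemma bary_coord_last (d : nat) (y : point) : bary_coord d y d = 1 - sumR d y.
Proof. unfold bary_coord; destruct (Nat.ltb_spec d d); [lia|reflexivity]. Qed.

Lemma bary_coord_child_map (d m j : nat) (y : point) : (m <= d)%nat -> (j <= d)%nat ->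
  bary_coord d (child_map d m y) j =
  (if Nat.eqb j m then 0 else bary_coord d y j) + bary_coord d y m / INR (S d).
Proof.
  intros Hm Hj; generalize (INR_S_pos d); intros Hd.
  destruct (Nat.eq_dec j d) as [->|Hjd].
  - rewrite bary_coord_last; unfold child_map at 1.
    rewrite sumR_plus, sumR_const.
    destruct (Nat.eqb_spec d m) as [<-|Hmd].
    + rewrite bary_coord_last.
      rewrite (sumR_ext d _ y) by (intros i Hi; destruct (Nat.eqb_spec i d); [lia|reflexivity]).
      rewrite S_INR in *; field; lra.
    + rewrite sumR_remove by lia; rewrite bary_coord_last, bary_coord_lt by lia.
      rewrite S_INR in *; field; lra.
  - rewrite bary_coord_lt by lia; unfold child_map.
    destruct (Nat.eqb j m); [reflexivity|]; now rewrite (bary_coord_lt d y j) by lia.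
Qed.

Lemma amap_child (d m : nat) (V : nat -> point) (y : point) (i : nat) : (m <= d)%nat ->
  amap d (child d V m) y i = amap d V (child_map d m y) i.
Proof.
  intros Hm; unfold amap; rewrite sumR_child by exact Hm.
  apply sumR_ext; intros j Hj; rewrite bary_coord_child_map by lia; reflexivity.
Qed.

Lemma swap_child_swap (d : nat) (y : point) (j : nat) : (1 <= d)%nat -> (j < d)%nat ->
  swap_map d (child_map d 0 (swap_map d y)) j = child_map d d y j.
Proof.
  intros Hd Hj; generalize (INR_S_pos d); intros HS.
  set (z := swap_map d y).
  assert (Hz0 : z O = 1 - sumR d y) by reflexivity.
  assert (Hz : sumR d z = 1 - y O).
  { unfold z, swap_map.
    rewrite (sumR_ext d _ (fun i => (if Nat.eqb i 0 then 0 else y i) +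
       (if Nat.eqb i 0 then 1 - sumR d y else 0)))
      by (intros i _; destruct (Nat.eqb i 0); ring).
    rewrite sumR_plus, sumR_remove by lia.
    rewrite (sumR_single d 0 (fun _ => 1 - sumR d y)) by lia; ring. }
  unfold child_map at 2; rewrite bary_coord_last.
  destruct (Nat.eqb_spec j d); [lia|].
  unfold swap_map at 1; destruct (Nat.eqb_spec j 0) as [->|Hj0].
  - unfold child_map; rewrite sumR_plus, sumR_remove, sumR_const by lia.
    rewrite bary_coord_lt, Hz, Hz0 by lia; rewrite S_INR in *; field; lra.
  - unfold child_map; rewrite bary_coord_lt, Hz0 by lia.
    destruct (Nat.eqb_spec j 0); [lia|].
    unfold z, swap_map; destruct (Nat.eqb_spec j 0); [lia|reflexivity].
Qed.

Definition image_on (d : nat) (F : point -> point) (X : point -> Prop) (y : point) : Prop :=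
  exists x, X x /\ forall k, (k < d)%nat -> y k = F x k.

(** Once all coordinates other than 0 are confined to width rho, coordinate 0 is merely reflected,
    up to an error of at most d * rho. So every factor A is 1. *)
Lemma content_le_swap_map (d : nat) (X : point -> Prop) (e : R) :
  content_le d X e -> content_le d (image_on d (swap_map d) X) e.
Proof.
  intros HX; rewrite <- (Rmult_1_l e).
  replace 1 with (prodR d (fun _ => 1)) by (rewrite prodR_const; apply pow1).
  apply content_le_image with (J := fun j => negb (Nat.eqb j 0)) (C := INR d)
    (F := swap_map d) (X := X); [intros; lra|apply pos_INR| |exact HX|auto].
  intros rho x y Hrho Hxy k Hk; unfold swap_map.
  destruct (Nat.eqb_spec k 0) as [->|Hk0]; simpl.
  - replace (1 - sumR d x - (1 - sumR d y)) with (- sumR d (fun i => x i + - 1 * y i))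
      by (rewrite sumR_plus, sumR_scal; ring).
    rewrite Rabs_Ropp; eapply Rle_trans; [apply sumR_abs|].
    apply Rle_trans with (sumR d (fun i => (if Nat.eqb i 0 then Rabs (x i - y i) else 0) + rho)).
    + apply sumR_le; intros i Hi; specialize (Hxy i Hi).
      replace (x i + - 1 * y i) with (x i - y i) by ring.
      destruct (Nat.eqb i 0); [lra|]; specialize (Hxy eq_refl); lra.
    + rewrite sumR_plus, sumR_const, (sumR_single d 0 (fun i => Rabs (x i - y i))) by lia; lra.
  - specialize (Hxy k Hk); destruct (Nat.eqb_spec k 0); [lia|].
    specialize (Hxy eq_refl); lra.
Qed.

Lemma prodR_single (n k : nat) (a : R) : (k < n)%nat ->
  prodR n (fun i => if Nat.eqb i k then a else 1) = a.
Proof.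
  induction n as [|n IH]; intros Hk; [lia|]; simpl.
  destruct (Nat.eqb_spec n k) as [->|Hn].
  - rewrite (prodR_ext k _ (fun _ => 1)); [rewrite prodR_const, pow1; ring|].
    intros i Hi; destruct (Nat.eqb_spec i k); [lia|reflexivity].
  - rewrite IH by lia; ring.
Qed.

(** Slabs are cut in the single direction m, which is contracted by 1/(d+1); on a thin slab every
    other coordinate is almost translated. *)
Lemma content_le_child_map_lt (d m : nat) (X : point -> Prop) (e : R) : (m < d)%nat ->
  content_le d X e -> content_le d (image_on d (child_map d m) X) (/ INR (S d) * e).
Proof.
  intros Hm HX; assert (Hd : 0 < / INR (S d)) by apply Rinv_0_lt_compat, INR_S_pos.
  replace (/ INR (S d)) with (prodR d (fun i => if Nat.eqb i m then / INR (S d) else 1))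
    by (apply prodR_single; exact Hm).
  apply content_le_image with (J := fun j => Nat.eqb j m) (C := / INR (S d))
    (F := child_map d m) (X := X); [|lra| |exact HX|auto].
  { intros k; destruct (Nat.eqb k m); lra. }
  intros rho x y Hrho Hxy k Hk; unfold child_map; rewrite !bary_coord_lt by lia.
  specialize (Hxy m Hm (Nat.eqb_refl m)).
  assert (Hm' : Rabs ((x m - y m) * / INR (S d)) <= / INR (S d) * rho).
  { rewrite Rabs_mult, (Rabs_right (/ INR (S d))) by lra; nra. }
  destruct (Nat.eqb_spec k m) as [->|Hkm].
  - replace (0 + x m / INR (S d) - (0 + y m / INR (S d))) with ((x m - y m) * / INR (S d))
      by (unfold Rdiv; ring); exact Hm'.
  - replace (x k + x m / INR (S d) - (y k + y m / INR (S d)))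
      with ((x k - y k) + (x m - y m) * / INR (S d)) by (unfold Rdiv; ring).
    eapply Rle_trans; [apply Rabs_triang|lra].
Qed.

Lemma content_le_child_map (d m : nat) (X : point -> Prop) (e : R) :
  (1 <= d)%nat -> (m <= d)%nat ->
  content_le d X e -> content_le d (image_on d (child_map d m) X) (/ INR (S d) * e).
Proof.
  intros Hd Hm HX; destruct (Nat.eq_dec m d) as [->|Hmd].
  - eapply content_le_weaken;
      [apply content_le_swap_map, (content_le_child_map_lt d 0), content_le_swap_map, HX; lia
      | |apply Rle_refl].
    intros y [x [Hx Hyx]].
    exists (child_map d 0 (swap_map d x)); split.
    + exists (swap_map d x); split; [exists x; auto|auto].
    + intros k Hk; rewrite swap_child_swap by assumption; auto.
  - apply content_le_child_map_lt; [lia|exact HX].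
Qed.

(** c plays the part of an upper bound for the absolute determinant of [amap d V]. Quantifying over
    all sets X lets the bound pass to children by composition. *)
Definition image_bound (d : nat) (V : nat -> point) (c : R) : Prop :=
  forall X e, content_le d X e -> content_le d (image_on d (amap d V) X) (c * e).

Lemma image_bound_child (d m : nat) (V : nat -> point) (c : R) :
  (1 <= d)%nat -> (m <= d)%nat ->
  image_bound d V c -> image_bound d (child d V m) (c / INR (S d)).
Proof.
  intros Hd Hm HV X e HX.
  eapply content_le_weaken; [apply HV, (content_le_child_map d m X e Hd Hm HX)| |].
  - intros y [x [Hx Hyx]]; exists (child_map d m x); split; [exists x; auto|].
    intros k Hk; rewrite (Hyx k Hk); apply amap_child; exact Hm.
  - apply Req_le; unfold Rdiv; ring.
Qed.

(** A crude Lipschitz constant per coordinate suffices: c multiplies a quantity that tends to 0, so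
    its size is irrelevant. *)
Lemma image_bound_exists (d : nat) (V : nat -> point) : (1 <= d)%nat ->
  exists c, 0 <= c /\ image_bound d V c.
Proof.
  intros Hd; set (A := fun k => sumR (S d) (fun j => INR d * Rabs (V j k))).
  assert (HA : forall k, 0 <= A k).
  { intros k; apply sumR_nonneg; intros j _; apply Rmult_le_pos; [apply pos_INR|apply Rabs_pos]. }
  exists (prodR d A); split; [apply prodR_nonneg; auto|].
  intros X e HX; apply content_le_image with (J := fun _ => true) (C := 0)
    (F := amap d V) (X := X); [exact HA|lra| |exact HX|auto].
  intros rho x y Hrho Hxy k Hk; simpl; unfold amap.
  replace (sumR (S d) (fun j => bary_coord d x j * V j k) - sumR (S d) (fun j => bary_coord d y j * V j k))
    with (sumR (S d) (fun j => bary_coord d x j * V j k + - 1 * (bary_coord d y j * V j k)))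
    by (rewrite sumR_plus, sumR_scal; ring).
  eapply Rle_trans; [apply sumR_abs|]; unfold A.
  rewrite Rmult_comm, <- sumR_scal; apply sumR_le; intros j Hj.
  replace (bary_coord d x j * V j k + - 1 * (bary_coord d y j * V j k))
    with ((bary_coord d x j - bary_coord d y j) * V j k) by ring.
  rewrite Rabs_mult, <- Rmult_assoc; apply Rmult_le_compat_r; [apply Rabs_pos|].
  assert (1 <= INR d) by (apply (le_INR 1); lia).
  unfold bary_coord; destruct (Nat.ltb_spec j d) as [Hjd|Hjd].
  - specialize (Hxy j Hjd eq_refl); nra.
  - replace (1 - sumR d x - (1 - sumR d y)) with (- sumR d (fun i => x i + - 1 * y i))
      by (rewrite sumR_plus, sumR_scal; ring).
    rewrite Rabs_Ropp; eapply Rle_trans; [apply sumR_abs|].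
    rewrite (Rmult_comm rho), <- sumR_const; apply sumR_le; intros i Hi.
    replace (x i + - 1 * y i) with (x i - y i) by ring; auto.
Qed.

(** The affine coordinates of points of the simplex lie in the unit cube; the loss against the
    standard simplex is a constant factor. *)
Lemma content_le_hull (d : nat) (V : nat -> point) (c : R) :
  image_bound d V c -> content_le d (simplex_hull d V) c.
Proof.
  intros HV.
  assert (HD : content_le d (fun y => forall j, (j < d)%nat -> 0 <= y j <= 1) 1).
  { intros eta Heta; exists (((fun _ => / 2), (fun _ => / 2)) :: nil); split; [split|].
    - intros b [<-|[]] i; simpl; lra.
    - intros x Hx; eexists; split; [now left|].
      intros i Hi; specialize (Hx i Hi); simpl; apply Rabs_le; lra.
    - simpl; unfold box_volume; simpl.
      rewrite (prodR_ext d _ (fun _ => 1)) by (intros; field).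
      rewrite prodR_const, pow1; lra. }
  eapply content_le_weaken; [apply HV, HD| |lra].
  intros x [_ [lam [Hpos [Hsum Hx]]]]; exists lam; split.
  - intros j Hj; split; [apply Hpos; lia|].
    rewrite <- Hsum; apply sumR_le_term; [intros; apply Hpos; lia|lia].
  - intros i Hi; rewrite (Hx i Hi); apply sumR_ext; intros j Hj; f_equal.
    unfold bary_coord; destruct (Nat.ltb_spec j d); [reflexivity|].
    simpl in Hsum; replace j with d by lia; lra.
Qed.

(** * Pure and mixed simplices *)

Lemma dist_nonneg (d : nat) (x y : point) : 0 <= dist d x y.
Proof. apply sqrt_pos. Qed.

Lemma dist_sq (d : nat) (x y : point) :
  dist d x y * dist d x y = sumR d (fun i => (x i - y i) ^ 2).
Proof. apply sqrt_sqrt, sumR_nonneg; intros; apply pow2_ge_0. Qed.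

Lemma dist_le (d : nat) (x y : point) (r : R) :
  0 <= r -> sumR d (fun i => (x i - y i) ^ 2) <= r * r -> dist d x y <= r.
Proof. intros Hr H; rewrite <- dist_sq in H; generalize (dist_nonneg d x y); nra. Qed.

Definition lin (d : nat) (g x : point) : R := sumR d (fun i => g i * x i).

Lemma lin_opp (d : nat) (g x : point) : lin d (fun i => - g i) x = - lin d g x.
Proof.
  unfold lin; rewrite (sumR_ext d _ (fun i => - 1 * (g i * x i))) by (intros; ring).
  rewrite sumR_scal; ring.
Qed.

(* An almost nearest point of P to y already gives a separating normal vector. *)
Lemma convex_separation (d : nat) (P : point -> Prop) (y : point) :
  convex_set d P -> closed_set d P -> bounded_set d P -> (exists p, P p) ->
  inRd d y -> ~ P y ->
  exists g, forall p, P p -> lin d g p < lin d g y.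
Proof.
  intros Hconv Hclosed [M HM] [p0 Hp0] Hy HnP.
  set (N := fun x : point => sumR d (fun i => (y i - x i) ^ 2)).
  assert (Hdelta : exists delta, 0 < delta /\ forall p, P p -> delta <= N p).
  { apply NNPP; intros H; apply HnP, Hclosed; [exact Hy|].
    intros delta Hdel; apply NNPP; intros H'.
    apply H; exists (delta * delta); split; [nra|].
    intros p Hp; unfold N; rewrite <- dist_sq.
    assert (delta <= dist d y p) by (apply Rnot_lt_le; intros Hlt; apply H'; eauto).
    apply Rmult_le_compat; lra. }
  destruct Hdelta as [delta [Hdel HN]].
  destruct (completeness (fun r => exists p, P p /\ r = - N p)) as [m [Hm1 Hm2]].
  { exists 0; intros r [p [Hp ->]]; specialize (HN p Hp); lra. }
  { exists (- N p0), p0; auto. }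
  assert (HM0 : 0 <= M) by (generalize (HM p0 p0 Hp0 Hp0) (dist_nonneg d p0 p0); lra).
  (* With x minimizing the squared distance N up to s * (delta / 2), moving from x towards p by the
     fraction s gains 2 * s * I to first order and loses at most s * s * M * M. This choice of s
     keeps the loss below s * (delta / 2), so I < delta <= N x. *)
  set (s := Rmin (1 / 2) (delta / (2 * (M * M + 1)))).
  assert (Hs : 0 < s <= 1 / 2 /\ s * (M * M + 1) <= delta / 2).
  { assert (0 < delta / (2 * (M * M + 1))) by (apply Rdiv_lt_0_compat; nra).
    unfold s; split; [split; [apply Rmin_glb_lt; lra|apply Rmin_l]|].
    apply Rle_trans with (delta / (2 * (M * M + 1)) * (M * M + 1)).
    - apply Rmult_le_compat_r; [nra|apply Rmin_r].
    - apply Req_le; field; nra. }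
  destruct Hs as [[Hs0 Hs1] Hs2].
  assert (Hx : exists x, P x /\ N x < - m + s * (delta / 2)).
  { apply NNPP; intros H; assert (m <= m - s * (delta / 2)); [|nra].
    apply Hm2; intros r [p [Hp ->]].
    apply Rnot_lt_le; intros Hlt; apply H; exists p; split; [exact Hp|lra]. }
  destruct Hx as [x [HPx Hxm]].
  exists (fun i => y i - x i); intros p Hp.
  assert (Hz := Hconv p x s Hp HPx ltac:(lra)).
  assert (Hzm : - m <= N (fun i => s * p i + (1 - s) * x i)).
  { enough (- N (fun i => s * p i + (1 - s) * x i) <= m) by lra.
    apply Hm1; eauto. }
  assert (Hpx : sumR d (fun i => (p i - x i) ^ 2) <= M * M).
  { rewrite <- dist_sq; generalize (HM p x Hp HPx) (dist_nonneg d p x); intros.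
    apply Rmult_le_compat; lra. }
  set (I := lin d (fun i => y i - x i) p - lin d (fun i => y i - x i) x).
  assert (E : N (fun i => s * p i + (1 - s) * x i) =
              N x + (- (2 * s)) * I + s * s * sumR d (fun i => (p i - x i) ^ 2)).
  { unfold N, I, lin.
    replace (sumR d (fun i => (y i - x i) * p i) - sumR d (fun i => (y i - x i) * x i))
      with (sumR d (fun i => (y i - x i) * p i + - 1 * ((y i - x i) * x i)))
      by (rewrite sumR_plus, sumR_scal; ring).
    rewrite <- !sumR_scal, <- !sumR_plus; apply sumR_ext; intros; ring. }
  assert (Ey : lin d (fun i => y i - x i) y = N x + lin d (fun i => y i - x i) x).
  { unfold N, lin; rewrite <- sumR_plus; apply sumR_ext; intros; ring. }
  assert (HI : I < delta).
  { apply Rmult_lt_reg_l with (2 * s); [lra|]. nra. }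
  specialize (HN x HPx); unfold I in HI; lra.
Qed.

(** * Descendants of a simplex and linear forms on them *)

Fixpoint descend (d : nat) (V : nat -> point) (w : list nat) : nat -> point :=
  match w with
  | nil => V
  | m :: w' => descend d (child d V m) w'
  end.

Definition is_word (d : nat) (w : list nat) : Prop := forall m, In m w -> (m <= d)%nat.

Lemma descend_app (d : nat) (w w' : list nat) (V : nat -> point) :
  descend d V (w ++ w') = descend d (descend d V w) w'.
Proof. revert V; induction w as [|m w IH]; intros V; simpl; auto. Qed.

Lemma hull_child (d m : nat) (V : nat -> point) (x : point) : (m <= d)%nat ->
  simplex_hull d (child d V m) x -> simplex_hull d V x.
Proof.
  intros Hm [Hx [lam [Hpos [Hsum E]]]]; split; [exact Hx|].
  exists (fun j => (if Nat.eqb j m then 0 else lam j) + lam m / INR (S d)); split; [|split].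
  - intros j Hj; assert (0 <= lam m / INR (S d)).
    { apply Rmult_le_pos; [auto|left; apply Rinv_0_lt_compat, INR_S_pos]. }
    specialize (Hpos j Hj); destruct (Nat.eqb j m); lra.
  - rewrite sumR_child_coordinates; assumption.
  - intros i Hi; rewrite (E i Hi); apply sumR_child; exact Hm.
Qed.

Lemma hull_descend (d : nat) (w : list nat) (V : nat -> point) (x : point) : is_word d w ->
  simplex_hull d (descend d V w) x -> simplex_hull d V x.
Proof.
  revert V; induction w as [|m w IH]; intros V Hw H; [exact H|].
  apply hull_child with m; [apply Hw; now left|].
  apply IH; [intros k Hk; apply Hw; now right|exact H].
Qed.

Lemma exists_argmin (d : nat) (f : nat -> R) :
  exists m, (m <= d)%nat /\ forall j, (j <= d)%nat -> f m <= f j.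
Proof.
  induction d as [|d [m [Hm IH]]].
  - exists O; split; [lia|]; intros j Hj; replace j with O by lia; lra.
  - destruct (Rle_dec (f m) (f (S d))) as [H|H].
    + exists m; split; [lia|]; intros j Hj.
      destruct (Nat.eq_dec j (S d)) as [->|]; [exact H|apply IH; lia].
    + exists (S d); split; [lia|]; intros j Hj.
      destruct (Nat.eq_dec j (S d)) as [->|]; [lra|].
      apply Rle_trans with (f m); [lra|apply IH; lia].
Qed.

(** Replace the vertex whose barycentric coordinate is smallest: this minimum can be subtracted from
    every coordinate, and d+1 times it becomes the weight of the barycenter. *)
Lemma hull_cover (d : nat) (V : nat -> point) (x : point) :
  simplex_hull d V x -> exists m, (m <= d)%nat /\ simplex_hull d (child d V m) x.
Proof.
  intros [Hx [lam [Hpos [Hsum E]]]].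
  destruct (exists_argmin d lam) as [m [Hm Hmin]]; exists m; split; [exact Hm|].
  split; [exact Hx|].
  set (al := fun j => if Nat.eqb j m then INR (S d) * lam m else lam j - lam m).
  assert (Hal : forall j, (if Nat.eqb j m then 0 else al j) + al m / INR (S d) = lam j).
  { intros j; unfold al; rewrite Nat.eqb_refl.
    replace (INR (S d) * lam m / INR (S d)) with (lam m)
      by (field; apply Rgt_not_eq, INR_S_pos).
    destruct (Nat.eqb_spec j m) as [->|]; ring. }
  exists al; split; [|split].
  - intros j Hj; unfold al; specialize (Hmin j Hj); destruct (Nat.eqb j m); [|lra].
    apply Rmult_le_pos; [left; apply INR_S_pos|auto].
  - rewrite <- (sumR_child_coordinates d m al Hm), <- Hsum; apply sumR_ext; auto.
  - intros i Hi; rewrite (E i Hi), sumR_child by exact Hm.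
    apply sumR_ext; intros j _; now rewrite Hal.
Qed.

Lemma lin_bary (d : nat) (V : nat -> point) (g : point) :
  lin d g (bary d V) = sumR (S d) (fun j => lin d g (V j)) / INR (S d).
Proof.
  unfold lin, bary; rewrite sumR_swap.
  unfold Rdiv; rewrite Rmult_comm, <- sumR_scal; apply sumR_ext; intros i _.
  rewrite sumR_scal; ring.
Qed.

Lemma lin_hull_le (d : nat) (V : nat -> point) (g x : point) (hi : R) :
  (forall j, (j <= d)%nat -> lin d g (V j) <= hi) -> simplex_hull d V x -> lin d g x <= hi.
Proof.
  intros Hhi [_ [lam [Hpos [Hsum E]]]].
  replace (lin d g x) with (sumR (S d) (fun j => lam j * lin d g (V j))).
  - rewrite <- (Rmult_1_r hi), <- Hsum, <- sumR_scal; apply sumR_le.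
    intros j Hj; rewrite (Rmult_comm hi); apply Rmult_le_compat_l; [apply Hpos|apply Hhi]; lia.
  - unfold lin; rewrite (sumR_ext d _ (fun i => sumR (S d) (fun j => lam j * (g i * V j i)))).
    + rewrite sumR_swap; apply sumR_ext; intros j _; now rewrite sumR_scal.
    + intros i Hi; rewrite (E i Hi), <- sumR_scal; apply sumR_ext; intros; ring.
Qed.

Lemma lin_bary_le (d i : nat) (V : nat -> point) (g : point) (hi s : R) : (i <= d)%nat ->
  (forall j, (j <= d)%nat -> lin d g (V j) <= hi) -> lin d g (V i) <= hi - s ->
  lin d g (bary d V) <= hi - s / INR (S d).
Proof.
  intros Hi Hhi Hs; assert (HS := INR_S_pos d); rewrite lin_bary.
  apply Rmult_le_reg_r with (INR (S d)); [exact HS|].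
  replace (sumR (S d) (fun j => lin d g (V j)) / INR (S d) * INR (S d))
    with (sumR (S d) (fun j => lin d g (V j))) by (field; lra).
  replace ((hi - s / INR (S d)) * INR (S d)) with (INR (S d) * hi + - s) by (field; lra).
  rewrite <- (sumR_const (S d) hi), <- (sumR_single (S d) i (fun _ => - s)) by lia.
  rewrite <- sumR_plus; apply sumR_le; intros j Hj.
  destruct (Nat.eqb_spec j i) as [->|]; [lra|]; rewrite Rplus_0_r; apply Hhi; lia.
Qed.

(* As long as vertex i stays in place, every new barycenter inherits a fraction
   1/(d+1) of its gap to hi. *)
Lemma lin_descend_le (d i : nat) (g : point) (hi s : R) (w : list nat) :
  (i <= d)%nat -> 0 <= s -> is_word d w -> ~ In i w ->
  forall (V : nat -> point) (old : nat -> Prop),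
  lin d g (V i) <= hi - s ->
  (forall j, (j <= d)%nat -> lin d g (V j) <= hi) ->
  (forall j, (j <= d)%nat -> old j -> lin d g (V j) <= hi - s / INR (S d)) ->
  descend d V w i = V i /\
  forall j, (j <= d)%nat -> old j \/ In j w ->
    lin d g (descend d V w j) <= hi - s / INR (S d).
Proof.
  intros Hi Hs; induction w as [|m w IH]; intros Hw Hiw V old H1 H2 H3; simpl.
  - split; [reflexivity|]; intros j Hj [Ho|[]]; auto.
  - assert (Him : i <> m) by (intros ->; apply Hiw; now left).
    assert (Hb : lin d g (bary d V) <= hi - s / INR (S d)) by (apply lin_bary_le with i; auto).
    assert (Hsd : 0 <= s / INR (S d)).
    { apply Rmult_le_pos; [exact Hs|left; apply Rinv_0_lt_compat, INR_S_pos]. }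
    assert (Ei : child d V m i = V i)
      by (unfold child; destruct (Nat.eqb_spec i m); [contradiction|reflexivity]).
    (* [old] collects the positions already replaced; it grows by m here, because the rest of the
       word may not mention m again. *)
    destruct (IH (fun k Hk => Hw k (or_intror Hk)) (fun H => Hiw (or_intror H))
                (child d V m) (fun j => old j \/ j = m)) as [K1 K2].
    + now rewrite Ei.
    + intros j Hj; unfold child; destruct (Nat.eqb j m); [lra|auto].
    + intros j Hj Ho; unfold child; destruct (Nat.eqb_spec j m); [exact Hb|].
      destruct Ho; [auto|contradiction].
    + split; [now rewrite K1|]; intros j Hj Ho; apply K2; [exact Hj|].
      destruct Ho as [Ho|[->|Ho]]; auto.
Qed.

(** One round that replaces every vertex except i, contracting the simplex towards vertex i in the
    sense of all linear forms at once. *)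
Definition sweep (d i : nat) : list nat :=
  filter (fun j => negb (Nat.eqb j i)) (seq 0 (S d)).

Lemma in_sweep (d i j : nat) : In j (sweep d i) <-> (j <= d)%nat /\ j <> i.
Proof.
  unfold sweep; rewrite filter_In, in_seq.
  destruct (Nat.eqb_spec j i); simpl; split; intros H; repeat split; try lia;
    destruct H; try lia; try discriminate; contradiction.
Qed.

Fixpoint sweeps (d i k : nat) : list nat :=
  match k with O => nil | S k' => sweep d i ++ sweeps d i k' end.

Lemma is_word_sweeps (d i k : nat) : is_word d (sweeps d i k).
Proof.
  induction k as [|k IH]; intros m Hm; [destruct Hm|].
  apply in_app_or in Hm; destruct Hm as [Hm|Hm]; [|auto].
  apply in_sweep in Hm; lia.
Qed.

Lemma length_sweeps (d i k : nat) : (length (sweeps d i k) <= k * S d)%nat.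
Proof.
  induction k as [|k IH]; simpl; [lia|]; rewrite length_app.
  assert (length (sweep d i) <= length (seq 0 (S d)))%nat by apply filter_length_le.
  rewrite length_seq in H; lia.
Qed.

(** In one sweep each replaced vertex gains at least 1/(d+1) of the gap r between the value at
    vertex i and the upper bound, so the excess over vertex i shrinks by the factor d/(d+1). *)
Lemma lin_sweeps_le (d i k : nat) (g : point) : (i <= d)%nat ->
  forall (V : nat -> point) (r : R), 0 <= r ->
  (forall j, (j <= d)%nat -> lin d g (V j) <= lin d g (V i) + r) ->
  forall j, (j <= d)%nat ->
    lin d g (descend d V (sweeps d i k) j) <= lin d g (V i) + (INR d / INR (S d)) ^ k * r.
Proof.
  intros Hi; assert (HS := INR_S_pos d); assert (Hd := pos_INR d).
  induction k as [|k IH]; intros V r Hr HV j Hj.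
  - simpl; specialize (HV j Hj); lra.
  - simpl sweeps; rewrite descend_app.
    destruct (lin_descend_le d i g (lin d g (V i) + r) r (sweep d i) Hi Hr) with
      (V := V) (old := fun _ : nat => False) as [K1 K2]; [| |lra|exact HV|tauto|].
    { intros m Hm; apply in_sweep in Hm; lia. }
    { intros Hm; apply in_sweep in Hm; lia. }
    assert (Er : r - r / INR (S d) = INR d / INR (S d) * r) by (rewrite S_INR in *; field; lra).
    assert (Hr' : 0 <= INR d / INR (S d) * r).
    { apply Rmult_le_pos; [apply Rmult_le_pos; [lra|left; apply Rinv_0_lt_compat; lra]|lra]. }
    eapply Rle_trans; [apply IH with (r := INR d / INR (S d) * r)|]; [exact Hr'| |exact Hj|].
    + intros l Hl; rewrite K1; destruct (Nat.eq_dec l i) as [->|Hli]; [rewrite K1; lra|].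
      specialize (K2 l Hl (or_intror (proj2 (in_sweep d i l) (conj Hl Hli)))); lra.
    + rewrite K1; simpl; apply Req_le; ring.
Qed.

(** The first barycenter inherits 1/(d+1) of the gap at j0. It stays at position 0 while the other
    vertices are replaced, and passes on 1/(d+1) of its own gap; hence the two divisions. *)
Lemma lin_center_le (d j0 : nat) (V : nat -> point) (g : point) (hi : R) : (j0 <= d)%nat ->
  (forall j, (j <= d)%nat -> lin d g (V j) <= hi) ->
  forall j, (j <= d)%nat ->
    lin d g (descend d V (seq 0 (S d)) j) <=
      hi - (hi - lin d g (V j0)) / INR (S d) / INR (S d).
Proof.
  intros Hj0 Hhi j Hj; simpl seq; simpl descend.
  assert (HS := INR_S_pos d); assert (HS1 : 1 <= INR (S d)) by (apply (le_INR 1); lia).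
  assert (Hb : lin d g (bary d V) <= hi - (hi - lin d g (V j0)) / INR (S d))
    by (apply lin_bary_le with j0; auto; lra).
  assert (Hs : 0 <= (hi - lin d g (V j0)) / INR (S d)).
  { apply Rmult_le_pos; [specialize (Hhi j0 Hj0); lra|left; apply Rinv_0_lt_compat; lra]. }
  destruct (lin_descend_le d 0 g hi ((hi - lin d g (V j0)) / INR (S d)) (seq 1 d)
              ltac:(lia) Hs) with (V := child d V 0) (old := fun j => j = O) as [_ K].
  - intros m Hm; apply in_seq in Hm; lia.
  - intros Hm; apply in_seq in Hm; lia.
  - exact Hb.
  - intros l Hl; unfold child; destruct (Nat.eqb l 0); [lra|auto].
  - intros l _ ->; unfold child; simpl Nat.eqb; cbv iota.
    eapply Rle_trans; [exact Hb|].
    enough ((hi - lin d g (V j0)) / INR (S d) / INR (S d) <= (hi - lin d g (V j0)) / INR (S d))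
      by lra.
    apply Rmult_le_reg_r with (INR (S d)); [lra|].
    unfold Rdiv at 1; rewrite Rmult_assoc, Rinv_l by lra; nra.
  - apply K; [exact Hj|]; destruct j as [|j]; [now left|right; apply in_seq; lia].
Qed.

Definition pure (d : nat) (P : point -> Prop) (V : nat -> point) : Prop :=
  (forall x, simplex_hull d V x -> P x) \/ (forall x, simplex_hull d V x -> ~ P x).

Lemma pure_descend (d : nat) (P : point -> Prop) (w : list nat) (V : nat -> point) :
  is_word d w -> pure d P V -> pure d P (descend d V w).
Proof.
  intros Hw [H|H]; [left|right]; intros x Hx; apply H; apply hull_descend with w; assumption.
Qed.

(* If P meets every descendant lying close to a vertex of V, then it contains the central
   one: a point of the latter cannot be separated from P by a linear form, because the form
   is larger near the vertex where it is maximal. *)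
Lemma exists_pure_descendant (d : nat) (P : point -> Prop) :
  convex_set d P -> closed_set d P -> bounded_set d P ->
  exists K, forall V, exists w, length w = K /\ is_word d w /\ pure d P (descend d V w).
Proof.
  intros Hconv Hclosed Hbdd; assert (HS := INR_S_pos d).
  (* After k sweeps a corner descendant is within less than 1/(d+1)^2 of the range of any form from
     its corner, closer than the central descendant can come. This k depends on d alone. *)
  destruct (pow_lt_1_zero (INR d / INR (S d))) with (y := / INR (S d) / INR (S d)) as [k Hk].
  { rewrite Rabs_right; [|apply Rle_ge, Rmult_le_pos;
      [apply pos_INR|left; apply Rinv_0_lt_compat; lra]].
    apply Rmult_lt_reg_r with (INR (S d)); [lra|].
    unfold Rdiv; rewrite Rmult_assoc, Rinv_l by lra; rewrite S_INR; lra. }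
  { apply Rdiv_lt_0_compat; [apply Rinv_0_lt_compat|]; lra. }
  specialize (Hk k (Nat.le_refl k)); apply Rabs_def2 in Hk; destruct Hk as [Hk _].
  exists (k * S d + S d)%nat; intros V.
  enough (exists w, (length w <= k * S d + S d)%nat /\ is_word d w /\ pure d P (descend d V w))
    as [w [Hlen [Hw Hpure]]].
  (* Purity is inherited, so a shorter word is padded with arbitrary letters to the common length
     K. *)
  { exists (w ++ repeat O (k * S d + S d - length w)); split; [|split].
    - rewrite length_app, repeat_length; lia.
    - intros m Hm; apply in_app_or in Hm; destruct Hm as [Hm|Hm]; [auto|].
      apply repeat_spec in Hm; lia.
    - rewrite descend_app; apply pure_descend; [|exact Hpure].
      intros m Hm; apply repeat_spec in Hm; lia. }
  destruct (classic (exists i, (i <= d)%nat /\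
    forall x, simplex_hull d (descend d V (sweeps d i k)) x -> ~ P x)) as [[i [Hi H]]|H].
  { exists (sweeps d i k); split; [generalize (length_sweeps d i k); lia|].
    split; [apply is_word_sweeps|right; exact H]. }
  assert (Hmeet : forall i, (i <= d)%nat ->
    exists x, simplex_hull d (descend d V (sweeps d i k)) x /\ P x).
  { intros i Hi; apply NNPP; intros Hn; apply H; exists i; split; [exact Hi|].
    intros x Hx HP; apply Hn; eauto. }
  exists (seq 0 (S d)); rewrite length_seq; split; [lia|]; split.
  { intros m Hm; apply in_seq in Hm; lia. }
  left; intros y Hy; apply NNPP; intros HnP.
  destruct (convex_separation d P y Hconv Hclosed Hbdd) as [g Hg]; [| |exact HnP|].
  { destruct (Hmeet O) as [x [_ Hx]]; [lia|eauto]. }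
  { apply Hy. }
  destruct (exists_argmin d (fun j => lin d g (V j))) as [j0 [Hj0 Hmin]].
  destruct (exists_argmin d (fun j => - lin d g (V j))) as [i0 [Hi0 Hmax]].
  destruct (Hmeet i0 Hi0) as [p [Hp HPp]]; specialize (Hg p HPp).
  cbv beta in Hmin, Hmax.
  assert (Hgap := Hmin i0 Hi0).
  assert (Hy' : lin d g y <=
      lin d g (V i0) - (lin d g (V i0) - lin d g (V j0)) / INR (S d) / INR (S d)).
  { apply (lin_hull_le d) with (2 := Hy); apply lin_center_le; [exact Hj0|].
    intros j Hj; specialize (Hmax j Hj); lra. }
  (* The sweep estimate for -g bounds g from below near the vertex i0 where g is largest; there p
     reaches at least the value at y, against the separation. *)
  assert (Hp' : lin d (fun i => - g i) p <= lin d (fun i => - g i) (V i0) +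
      (INR d / INR (S d)) ^ k * (lin d g (V i0) - lin d g (V j0))).
  { apply (lin_hull_le d) with (2 := Hp); apply lin_sweeps_le; [exact Hi0|lra|].
    intros j Hj; rewrite !lin_opp; specialize (Hmin j Hj); lra. }
  rewrite !lin_opp in Hp'; unfold Rdiv in Hy', Hk; rewrite Rmult_assoc in Hy'.
  unfold Rdiv in Hp'; nra.
Qed.

(** * Decay of the content of the mixed simplices *)

Definition mixed_level (d : nat) (P : point -> Prop) (n : nat) (V : nat -> point)
    (x : point) : Prop :=
  exists w, length w = n /\ is_word d w /\ ~ pure d P (descend d V w) /\
    simplex_hull d (descend d V w) x.

Lemma mixed_level_S (d : nat) (P : point -> Prop) (n : nat) (V : nat -> point) (x : point) :
  mixed_level d P (S n) V x -> exists m, (m < S d)%nat /\ mixed_level d P n (child d V m) x.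
Proof.
  intros [[|m w] [Hlen [Hw [Hp Hx]]]]; [discriminate|].
  exists m; split; [apply le_n_S, Hw; now left|].
  exists w; split; [now injection Hlen|].
  split; [intros k Hk; apply Hw; now right|auto].
Qed.

Section MixedContent.

Variables (d : nat) (P : point -> Prop).
Hypothesis d_pos : (1 <= d)%nat.

(** beta bounds the mixed proportion after n generations for every starting simplex, so that the
    bound can be applied again inside each descendant. *)
Definition mixed_content_le (n : nat) (beta : R) : Prop :=
  forall V c, 0 <= c -> image_bound d V c -> content_le d (mixed_level d P n V) (c * beta).

Lemma child_bound_nonneg (c : R) : 0 <= c -> 0 <= c / INR (S d).
Proof.
  intros Hc; apply Rmult_le_pos; [exact Hc|left; apply Rinv_0_lt_compat, INR_S_pos].
Qed.

Lemma mixed_content_add (k n : nat) (beta : R) :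
  mixed_content_le n beta -> mixed_content_le (k + n) beta.
Proof.
  intros Hn; induction k as [|k IH]; [exact Hn|]; intros V c Hc HV; simpl.
  replace (c * beta) with (sumR (S d) (fun _ => c / INR (S d) * beta))
    by (rewrite sumR_const; field; apply Rgt_not_eq, INR_S_pos).
  apply content_le_finite_union with (X := fun m => mixed_level d P (k + n) (child d V m)).
  - intros m Hm; apply IH; [now apply child_bound_nonneg|].
    apply image_bound_child; [exact d_pos|lia|exact HV].
  - intros x Hx; apply mixed_level_S; exact Hx.
Qed.

(** Follow the word w to the pure descendant: every simplex branching off contributes its full share
    times beta, the end of the path nothing. What is saved is the share (d+1)^-|w| of that one
    descendant. *)
Lemma mixed_content_pure (n : nat) (beta : R) : mixed_content_le n beta ->
  forall w V c, is_word d w -> pure d P (descend d V w) -> 0 <= c -> image_bound d V c ->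
  content_le d (mixed_level d P (length w + n) V) (c * (beta * (1 - (/ INR (S d)) ^ length w))).
Proof.
  intros Hn; assert (HS := INR_S_pos d); induction w as [|m w IH]; intros V c Hw Hp Hc HV.
  - simpl; replace (c * (beta * (1 - 1))) with 0 by ring.
    apply content_le_empty; intros x [w [_ [Hw' [Hnp _]]]].
    apply Hnp, pure_descend; assumption.
  - assert (Hm : (m <= d)%nat) by (apply Hw; now left).
    set (q := (/ INR (S d)) ^ length w).
    replace (c * (beta * (1 - (/ INR (S d)) ^ length (m :: w))))
      with (sumR (S d) (fun k => c / INR (S d) * beta +
               (if Nat.eqb k m then - (c / INR (S d) * beta * q) else 0))).
    2: { rewrite sumR_plus, sumR_const.
         rewrite (sumR_single (S d) m (fun _ => - (c / INR (S d) * beta * q))) by lia.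
         simpl length; rewrite <- tech_pow_Rmult; fold q; field; lra. }
    apply content_le_finite_union
      with (X := fun k => mixed_level d P (length w + n) (child d V k)).
    + intros k Hk.
      assert (Hck := child_bound_nonneg c Hc).
      assert (Hk' : image_bound d (child d V k) (c / INR (S d)))
        by (apply image_bound_child; [exact d_pos|lia|exact HV]).
      destruct (Nat.eqb_spec k m) as [->|].
      * eapply content_le_weaken; [apply IH with (c := c / INR (S d))|intros x Hx; exact Hx|].
        { intros j Hj; apply Hw; now right. }
        { exact Hp. }
        { exact Hck. }
        { exact Hk'. }
        { apply Req_le; fold q; ring. }
      * rewrite Rplus_0_r; apply mixed_content_add; assumption.
    + intros x Hx; apply mixed_level_S; exact Hx.
Qed.

Lemma mixed_content_decay (K : nat) :
  (forall V, exists w, length w = K /\ is_word d w /\ pure d P (descend d V w)) ->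
  forall j, mixed_content_le (j * K) ((1 - (/ INR (S d)) ^ K) ^ j).
Proof.
  intros HK; induction j as [|j IH]; intros V c Hc HV.
  - simpl; rewrite Rmult_1_r.
    eapply content_le_weaken; [apply content_le_hull, HV| |apply Rle_refl].
    intros x [w [_ [Hw [_ Hx]]]]; apply hull_descend with w; assumption.
  - destruct (HK V) as [w [Hlen [Hw Hp]]].
    generalize (mixed_content_pure _ _ IH w V c Hw Hp Hc HV).
    rewrite Hlen; simpl; rewrite (Rmult_comm ((1 - _) ^ j)); auto.
Qed.

End MixedContent.

(** * Facets have content zero *)

Definition facet (d m : nat) (V : nat -> point) (x : point) : Prop :=
  inRd d x /\ exists lam : nat -> R,
    (forall j, (j <= d)%nat -> 0 <= lam j) /\ sumR (S d) lam = 1 /\ lam m = 0 /\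
    forall i, (i < d)%nat -> x i = sumR (S d) (fun j => lam j * V j i).

(* Replacing vertex m does not affect the facet opposite to it, which therefore lies in
   simplices of arbitrarily small content. *)
Lemma content_le_facet (d m : nat) (V : nat -> point) (c : R) :
  (1 <= d)%nat -> (m <= d)%nat -> 0 <= c -> image_bound d V c -> content_le d (facet d m V) 0.
Proof.
  intros Hd Hm Hc HV; assert (HS := INR_S_pos d).
  assert (Hk : forall k V c, image_bound d V c ->
    content_le d (facet d m V) (c * (/ INR (S d)) ^ k)).
  { clear V c Hc HV; induction k as [|k IH]; intros V c HV.
    - eapply content_le_weaken; [apply content_le_hull, HV| |simpl; lra].
      intros x [Hx [lam [H1 [H2 [_ H3]]]]]; split; eauto.
    - eapply content_le_weaken; [apply IH, (image_bound_child d m V c Hd Hm HV)| |].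
      + intros x [Hx [lam [H1 [H2 [H3 H4]]]]]; split; [exact Hx|].
        exists lam; repeat split; auto.
        intros i Hi; rewrite (H4 i Hi); apply sumR_ext; intros j _; unfold child.
        destruct (Nat.eqb_spec j m) as [->|]; [rewrite H3; ring|reflexivity].
      + apply Req_le; simpl; unfold Rdiv; ring. }
  intros eta Heta.
  assert (HS2 : 2 <= INR (S d)) by (apply (le_INR 2); lia).
  assert (Hi : 0 < / INR (S d)) by (apply Rinv_0_lt_compat; lra).
  destruct (pow_lt_1_zero (/ INR (S d))) with (y := eta / (2 * (c + 1))) as [k Hk'].
  { rewrite Rabs_right by lra; rewrite <- Rinv_1; apply Rinv_lt_contravar; lra. }
  { apply Rdiv_lt_0_compat; lra. }
  specialize (Hk' k (Nat.le_refl k)); apply Rabs_def2 in Hk'; destruct Hk' as [Hk' _].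
  destruct (Hk k V c HV (eta / 2)) as [l [H1 H2]]; [lra|].
  exists l; split; [exact H1|].
  assert (E : eta / (2 * (c + 1)) * (c + 1) = eta / 2) by (field; lra).
  assert (0 < (/ INR (S d)) ^ k) by (apply pow_lt; lra).
  nra.
Qed.

Definition facet_level (d n : nat) (V : nat -> point) (x : point) : Prop :=
  exists w m, length w = n /\ is_word d w /\ (m <= d)%nat /\ facet d m (descend d V w) x.

Lemma content_le_facet_level (d n : nat) (V : nat -> point) (c : R) :
  (1 <= d)%nat -> 0 <= c -> image_bound d V c -> content_le d (facet_level d n V) 0.
Proof.
  intros Hd; revert V c; induction n as [|n IH]; intros V c Hc HV;
    (replace 0 with (sumR (S d) (fun _ => 0)) by (rewrite sumR_const; ring)).
  - apply content_le_finite_union with (X := fun m => facet d m V).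
    + intros m Hm; apply content_le_facet with c; auto; lia.
    + intros x [[|k w] [m [Hlen [_ [Hm Hx]]]]]; [|discriminate].
      exists m; split; [lia|exact Hx].
  - apply content_le_finite_union with (X := fun m => facet_level d n (child d V m)).
    + intros m Hm; apply IH with (c / INR (S d)); [now apply child_bound_nonneg|].
      apply image_bound_child; [exact Hd|lia|exact HV].
    + intros x [[|k w] [m [Hlen [Hw [Hm Hx]]]]]; [discriminate|].
      exists k; split; [apply le_n_S, Hw; now left|].
      exists w, m; split; [now injection Hlen|].
      split; [intros j Hj; apply Hw; now right|auto].
Qed.

(** * Nested barycentric systems *)

Lemma Rabs_le_inv (x a : R) : Rabs x <= a -> - a <= x <= a.
Proof. unfold Rabs; destruct Rcase_abs; lra. Qed.

Lemma sumR_shift (n : nat) (f : nat -> R) : sumR (S n) f = f O + sumR n (fun k => f (S k)).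
Proof. induction n as [|n IH]; [simpl; ring|]. simpl in *; rewrite IH; ring. Qed.

Lemma volume_lt_content (d : nat) (X : point -> Prop) (e c : R) :
  (1 <= d)%nat -> content_le d X e -> e < c -> volume_lt d X c.
Proof.
  intros Hd HX Hec; destruct (HX ((c - e) / 2)) as [l [[H1 H2] H3]]; [lra|].
  (* The list is padded to an infinite sequence by a degenerate box at the origin, of volume 0
     because 1 <= d. *)
  set (b0 := ((fun _ : nat => 0), (fun _ : nat => 0)) : point * point).
  set (b := fun k => nth k l b0).
  exists (fun k i => fst (b k) i - snd (b k) i), (fun k i => fst (b k) i + snd (b k) i),
    (total_volume d l); split; [split; [|split]|lra].
  - intros k i; unfold b; destruct (nth_in_or_default k l b0) as [Hin| ->].
    + specialize (H1 _ Hin i); lra.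
    + simpl; lra.
  - intros x Hx; destruct (H2 x Hx) as [bx [Hin Hbx]].
    destruct (In_nth l bx b0 Hin) as [k [_ Hk]]; exists k; intros i Hi.
    unfold b; rewrite Hk; specialize (Hbx i Hi); apply Rabs_le_inv in Hbx; lra.
  - assert (Hsum : forall n, (length l <= n)%nat ->
      sumR n (fun k => box_volume d (b k)) = total_volume d l).
    { unfold b; clear - Hd; induction l as [|c l IH]; intros n Hn.
      - simpl total_volume; rewrite (sumR_ext n _ (fun _ => box_volume d b0))
          by (intros [|i] _; reflexivity).
        rewrite sumR_const; unfold box_volume, b0.
        rewrite (prodR_ext d _ (fun _ => 0)), prodR_const, pow_i by (simpl; intros; ring || lia).
        ring.
      - destruct n as [|n]; [simpl in Hn; lia|]; rewrite sumR_shift; simpl in *.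
        rewrite IH by lia; reflexivity. }
    assert (E : forall n, sum_f_R0 (fun k => prodR d (fun i => fst (b k) i + snd (b k) i -
        (fst (b k) i - snd (b k) i))) n = sumR (S n) (fun k => box_volume d (b k))).
    { assert (Ek : forall k, prodR d (fun i => fst (b k) i + snd (b k) i -
        (fst (b k) i - snd (b k) i)) = box_volume d (b k))
        by (intros k; apply prodR_ext; intros; ring).
      induction n as [|n IH]; [simpl; rewrite Ek; ring|].
      simpl sum_f_R0; rewrite IH, Ek; reflexivity. }
    intros eps Heps; exists (length l); intros n Hn.
    rewrite E, Hsum by lia; unfold Rdist; rewrite Rminus_diag, Rabs_R0; exact Heps.
Qed.

(** * Index lists and the simplices they describe *)

Lemma length_replace_nth (s : list nat) (m c : nat) : length (replace_nth s m c) = length s.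
Proof. revert m; induction s as [|y s IH]; intros [|m]; simpl; auto. Qed.

Lemma in_replace_nth (s : list nat) (m c j : nat) :
  In j (replace_nth s m c) -> j = c \/ In j s.
Proof.
  revert m; induction s as [|y s IH]; intros [|m]; simpl; intros H; auto.
  - destruct H; auto.
  - destruct H as [H|H]; [auto|]; destruct (IH _ H); auto.
Qed.

Lemma nth_replace_nth (s : list nat) (m c j : nat) : (m < length s)%nat ->
  nth j (replace_nth s m c) O = if Nat.eqb j m then c else nth j s O.
Proof.
  revert m j; induction s as [|y s IH]; intros [|m] j Hm; simpl in Hm; try lia.
  - destruct j; reflexivity.
  - destruct j as [|j]; simpl; [reflexivity|]; apply IH; lia.
Qed.

Lemma NoDup_replace_nth (s : list nat) (m c : nat) :
  NoDup s -> ~ In c s -> NoDup (replace_nth s m c).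
Proof.
  intros Hs; revert m; induction Hs as [|y s Hy Hs IH]; intros m Hc;
    [destruct m; constructor|].
  destruct m as [|m]; simpl.
  - constructor; [intros H; apply Hc; now right|exact Hs].
  - constructor; [|apply IH; intros H; apply Hc; now right].
    intros H; apply in_replace_nth in H; destruct H as [->|H]; [|contradiction].
    apply Hc; now left.
Qed.

Lemma barycentric_nbs_wf (d : nat) (q : nat -> point) (t : nat) (T : list (list nat)) :
  barycentric_nbs d q t T ->
  (d <= t)%nat /\ forall s, In s T ->
    length s = S d /\ NoDup s /\ forall j, In j s -> (j <= t)%nat.
Proof.
  induction 1 as [|t T1 s T2 _ [Ht IH] _].
  - split; [lia|]; intros s [<-|[]]; split; [apply length_seq|split; [apply seq_NoDup|]].
    intros j Hj; apply in_seq in Hj; lia.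
  - split; [lia|]; intros s' Hs'.
    assert (Hold : In s' (T1 ++ s :: T2) ->
      length s' = S d /\ NoDup s' /\ forall j, In j s' -> (j <= S t)%nat).
    { intros H; destruct (IH s' H) as [A1 [A2 A3]]; repeat split; auto. }
    apply in_app_or in Hs'; destruct Hs' as [Hs'|Hs'];
      [apply Hold, in_or_app; now left|].
    apply in_app_or in Hs'; destruct Hs' as [Hs'|Hs'];
      [|apply Hold, in_or_app; right; now right].
    apply in_map_iff in Hs'; destruct Hs' as [m [<- _]].
    destruct (IH s) as [A1 [A2 A3]]; [apply in_or_app; right; now left|].
    rewrite length_replace_nth; split; [exact A1|split].
    + apply NoDup_replace_nth; [exact A2|]; intros H; specialize (A3 _ H); lia.
    + intros j Hj; apply in_replace_nth in Hj; destruct Hj as [->|Hj]; [lia|].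
      specialize (A3 _ Hj); lia.
Qed.

Lemma barycenter_ext (q q' : nat -> point) (s : list nat) :
  (forall j, In j s -> q' j = q j) -> barycenter q' s = barycenter q s.
Proof.
  intros H; apply functional_extensionality; intros i; unfold barycenter; f_equal.
  induction s as [|j s IH]; [reflexivity|]; simpl.
  rewrite IH, (H j); [reflexivity|now left|intros k Hk; apply H; now right].
Qed.

(** The system up to time t uses only points of index at most t; the sequence may therefore be
    redefined at S t to install the next split point. *)
Lemma barycentric_nbs_ext (d : nat) (q q' : nat -> point) (t : nat) (T : list (list nat)) :
  barycentric_nbs d q t T -> (forall j, (j <= t)%nat -> q' j = q j) ->
  barycentric_nbs d q' t T.
Proof.
  induction 1 as [|t T1 s T2 H IH Hq]; intros Hext; constructor.
  - apply IH; intros j Hj; apply Hext; lia.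
  - rewrite Hext, Hq by lia; symmetry; apply barycenter_ext; intros j Hj; apply Hext.
    destruct (barycentric_nbs_wf _ _ _ _ H) as [_ Hwf].
    destruct (Hwf s) as [_ [_ Hs]]; [apply in_or_app; right; now left|].
    specialize (Hs j Hj); lia.
Qed.

Definition geom (q : nat -> point) (s : list nat) : nat -> point := fun j => q (nth j s O).

Lemma barycenter_bary (d : nat) (q : nat -> point) (s : list nat) :
  length s = S d -> barycenter q s = bary d (geom q s).
Proof.
  intros Hs; apply functional_extensionality; intros i; unfold barycenter, bary, geom.
  rewrite <- Hs; f_equal; clear Hs; induction s as [|j s IH]; [reflexivity|].
  simpl fold_right; rewrite IH; simpl length; now rewrite sumR_shift.
Qed.

(** Replacement keeps positions, so splitting index lists matches [child] position by position and
    the words of [descend] carry over. *)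
Lemma geom_replace_nth (d m c : nat) (q : nat -> point) (s : list nat) :
  length s = S d -> (m <= d)%nat -> q c = barycenter q s ->
  geom q (replace_nth s m c) = child d (geom q s) m.
Proof.
  intros Hs Hm Hq; apply functional_extensionality; intros j; unfold geom at 1, child.
  rewrite nth_replace_nth by lia; destruct (Nat.eqb j m); [|reflexivity].
  rewrite Hq; now apply barycenter_bary.
Qed.

(** * Splitting every simplex of a triangulation *)

Fixpoint split_all (t : nat) (L : list (list nat)) : list (list nat) :=
  match L with
  | nil => nil
  | s :: L' => map (fun m => replace_nth s m (S t)) (seq 0 (length s)) ++ split_all (S t) L'
  end.

Lemma in_split_all (t : nat) (L : list (list nat)) (s : list nat) :
  In s (split_all t L) <->
  exists i m, (i < length L)%nat /\ (m < length (nth i L nil))%nat /\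
    s = replace_nth (nth i L nil) m (S t + i).
Proof.
  revert t; induction L as [|s0 L IH]; intros t; simpl split_all.
  - split; [intros []|intros [i [m [Hi _]]]; simpl in Hi; lia].
  - rewrite in_app_iff, in_map_iff, IH; split.
    + intros [[m [<- Hm]]|[i [m [Hi [Hm ->]]]]].
      * exists O, m; apply in_seq in Hm; rewrite Nat.add_0_r; simpl; repeat split; lia.
      * exists (S i), m; simpl; rewrite <- plus_n_Sm; repeat split; [lia|exact Hm].
    + intros [[|i] [m [Hi [Hm ->]]]]; simpl in *.
      * left; exists m; rewrite Nat.add_0_r; split; [reflexivity|apply in_seq; lia].
      * right; exists i, m; rewrite <- plus_n_Sm; repeat split; [lia|exact Hm].
Qed.

(** A single step splits one simplex; the prefix T1 absorbs the children already produced, so the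
    induction can run along the simplices still to be split. The i-th of them receives the index S t
    + i. *)
Lemma barycentric_nbs_split_all (d : nat) (L : list (list nat)) :
  forall (q : nat -> point) (t : nat) (T1 : list (list nat)),
  barycentric_nbs d q t (T1 ++ L) ->
  exists q', (forall j, (j <= t)%nat -> q' j = q j) /\
    barycentric_nbs d q' (t + length L) (T1 ++ split_all t L) /\
    forall i, (i < length L)%nat -> q' (S t + i)%nat = barycenter q' (nth i L nil).
Proof.
  induction L as [|s L IH]; intros q t T1 H.
  - exists q; simpl; rewrite Nat.add_0_r; repeat split; [exact H|intros; lia].
  - set (q1 := fun j => if Nat.eqb j (S t) then barycenter q s else q j).
    assert (Hq1 : forall j, (j <= t)%nat -> q1 j = q j).
    { intros j Hj; unfold q1; destruct (Nat.eqb_spec j (S t)); [lia|reflexivity]. }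
    destruct (barycentric_nbs_wf _ _ _ _ H) as [_ Hwf].
    assert (Hs : forall j, In j s -> (j <= t)%nat)
      by (apply Hwf, in_or_app; right; now left).
    assert (Hb : q1 (S t) = barycenter q1 s).
    { rewrite (barycenter_ext q q1) by (intros; apply Hq1; auto).
      unfold q1; now rewrite Nat.eqb_refl. }
    assert (H1 := nbs_step d q1 t T1 s L (barycentric_nbs_ext _ _ _ _ _ H Hq1) Hb).
    rewrite app_assoc in H1; destruct (IH q1 (S t) _ H1) as [q' [A1 [A2 A3]]].
    exists q'; split; [|split].
    + intros j Hj; rewrite A1 by lia; auto.
    + simpl; rewrite app_assoc, <- plus_n_Sm; exact A2.
    + intros [|i] Hi.
      * rewrite Nat.add_0_r, A1 by lia; rewrite Hb; symmetry; apply barycenter_ext.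
        intros j Hj; apply A1; specialize (Hs j Hj); lia.
      * rewrite <- plus_n_Sm; apply A3; simpl in Hi; lia.
Qed.

Lemma geom_ext (d t : nat) (q q' : nat -> point) (s : list nat) :
  length s = S d -> (forall j, In j s -> (j <= t)%nat) ->
  (forall j, (j <= t)%nat -> q' j = q j) -> geom q' s = geom q s.
Proof.
  intros Hlen Hs Hq; apply functional_extensionality; intros j; unfold geom; apply Hq.
  (* Past the end of s the default index 0 is read, which is at most t as well; this gives equality
     as functions. *)
  destruct (nth_in_or_default j s O) as [H| ->]; [auto|lia].
Qed.

Definition full_subdivision (d n : nat) (V q : nat -> point) (t : nat)
    (T : list (list nat)) : Prop :=
  barycentric_nbs d q t T /\
  (forall s, In s T -> exists w, length w = n /\ is_word d w /\ geom q s = descend d V w) /\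
  (forall x, simplex_hull d V x -> exists s, In s T /\ simplex_hull d (geom q s) x).

Lemma full_subdivision_exists (d n : nat) (v : nat -> point) :
  exists q t T, (forall j, (j <= d)%nat -> q j = v j) /\
    full_subdivision d n (geom v (seq 0 (S d))) q t T.
Proof.
  (* V agrees with v up to position d and is v 0 beyond; it is used in place of v so that the
     identities with [descend] hold as equalities of functions. *)
  set (V := geom v (seq 0 (S d))); induction n as [|n IH].
  - exists v, d, (seq 0 (S d) :: nil); split; [auto|split; [constructor|split]].
    + intros s [<-|[]]; exists nil; repeat split; intros m [].
    + intros x Hx; exists (seq 0 (S d)); split; [now left|exact Hx].
  - destruct IH as [q [t [T [Hq [Hnbs [Hgeom Hcov]]]]]].
    destruct (barycentric_nbs_wf _ _ _ _ Hnbs) as [Hdt Hwf].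
    destruct (barycentric_nbs_split_all d T q t nil Hnbs) as [q' [A1 [A2 A3]]].
    exists q', (t + length T)%nat, (split_all t T); split; [|split; [exact A2|]].
    { intros j Hj; rewrite A1 by lia; auto. }
    assert (Hg : forall s, In s T -> geom q' s = geom q s).
    { intros s Hs; destruct (Hwf s Hs) as [L1 [_ L2]]; now apply geom_ext with d t. }
    split.
    + intros s Hs; apply in_split_all in Hs; destruct Hs as [i [m [Hi [Hm ->]]]].
      assert (Hin : In (nth i T nil) T) by (apply nth_In; exact Hi).
      destruct (Hwf _ Hin) as [L1 _]; rewrite L1 in Hm.
      destruct (Hgeom _ Hin) as [w [W1 [W2 W3]]]; exists (w ++ m :: nil); split; [|split].
      * rewrite length_app; simpl; lia.
      * intros k Hk; apply in_app_or in Hk; destruct Hk as [Hk|[<-|[]]]; [auto|lia].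
      * rewrite (geom_replace_nth d) by (auto; lia).
        rewrite Hg, W3, descend_app by exact Hin; reflexivity.
    + intros x Hx; destruct (Hcov x Hx) as [s [Hs Hxs]].
      destruct (Hwf s Hs) as [L1 _].
      destruct (In_nth T s nil Hs) as [i [Hi Hsi]].
      destruct (hull_cover d (geom q s) x Hxs) as [m [Hm Hxm]].
      exists (replace_nth s m (S t + i)); split.
      * apply in_split_all; exists i, m; rewrite Hsi; repeat split; lia.
      * rewrite (geom_replace_nth d); [rewrite Hg; assumption|exact L1|exact Hm|].
        rewrite A3, Hsi by exact Hi; reflexivity.
Qed.

(** * Coordinates by position and coordinates by index *)

Lemma sumR_over_indices (d t : nat) (s : list nat) (lam f : nat -> R) :
  length s = S d -> (forall j, In j s -> (j <= t)%nat) ->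
  sumR (S t) (fun j => sumR (S d) (fun k => if Nat.eqb (nth k s O) j then lam k else 0) * f j) =
  sumR (S d) (fun k => lam k * f (nth k s O)).
Proof.
  intros Hlen Hs.
  rewrite (sumR_ext (S t) _ (fun j => sumR (S d) (fun k =>
     f j * (if Nat.eqb (nth k s O) j then lam k else 0))))
    by (intros j _; rewrite sumR_scal; ring).
  rewrite sumR_swap; apply sumR_ext; intros k Hk.
  rewrite (sumR_ext _ _ (fun j => if Nat.eqb j (nth k s O) then f j * lam k else 0)).
  - rewrite sumR_single; [ring|].
    apply le_n_S, Hs, nth_In; lia.
  - intros j _; rewrite Nat.eqb_sym; destruct (Nat.eqb j (nth k s O)); ring.
Qed.

Lemma is_phi_of_hull (d t : nat) (q : nat -> point) (T : list (list nat)) (s : list nat)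
    (x : point) :
  barycentric_nbs d q t T -> In s T -> simplex_hull d (geom q s) x ->
  exists alpha, is_phi d q t T x alpha /\ forall j, 0 < alpha j -> In j s.
Proof.
  intros Hnbs Hs [_ [lam [Hpos [Hsum Hx]]]].
  destruct (barycentric_nbs_wf _ _ _ _ Hnbs) as [_ Hwf].
  destruct (Hwf s Hs) as [Hlen [_ Hle]].
  set (alpha := fun j => sumR (S d) (fun k => if Nat.eqb (nth k s O) j then lam k else 0)).
  assert (H0 : forall j, ~ In j s -> alpha j = 0).
  { intros j Hj; unfold alpha; rewrite (sumR_ext _ _ (fun _ => 0));
      [rewrite sumR_const; ring|].
    intros k Hk; destruct (Nat.eqb_spec (nth k s O) j) as [E|]; [|reflexivity].
    destruct Hj; rewrite <- E; apply nth_In; lia. }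
  exists alpha; split.
  - exists s; split; [exact Hs|split; [exact H0|split; [|split]]].
    + intros j; apply sumR_nonneg; intros k Hk; destruct (Nat.eqb (nth k s O) j); [|lra].
      apply Hpos; lia.
    + rewrite <- Hsum, (sumR_ext (S t) alpha (fun j => alpha j * 1)) by (intros; ring).
      unfold alpha; rewrite (sumR_over_indices d t s lam (fun _ => 1)) by assumption.
      apply sumR_ext; intros; ring.
    + intros i Hi; rewrite (Hx i Hi).
      unfold alpha; now rewrite (sumR_over_indices d t s lam (fun j => q j i)).
  - intros j Hj; apply NNPP; intros Hn; rewrite H0 in Hj by exact Hn; lra.
Qed.

(** Each index of s occurs at exactly one position by [NoDup], so no coordinate is counted twice. *)
Lemma sumR_supported (d t : nat) (s : list nat) (alpha f : nat -> R) :
  length s = S d -> NoDup s -> (forall j, In j s -> (j <= t)%nat) ->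
  (forall j, ~ In j s -> alpha j = 0) ->
  sumR (S t) (fun j => alpha j * f j) =
  sumR (S d) (fun k => alpha (nth k s O) * f (nth k s O)).
Proof.
  intros Hlen Hnd Hle H0.
  rewrite <- (sumR_over_indices d t s (fun k => alpha (nth k s O)) f Hlen Hle).
  apply sumR_ext; intros j _; f_equal.
  destruct (in_dec Nat.eq_dec j s) as [Hj|Hj].
  - destruct (In_nth s j O Hj) as [k0 [Hk0 <-]].
    rewrite (sumR_ext _ _ (fun k => if Nat.eqb k k0 then alpha (nth k s O) else 0)).
    + rewrite sumR_single by lia; reflexivity.
    + intros k Hk; destruct (Nat.eqb_spec k k0) as [->|Hkk]; [now rewrite Nat.eqb_refl|].
      destruct (Nat.eqb_spec (nth k s O) (nth k0 s O)) as [E|]; [|reflexivity].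
      destruct Hkk; apply (proj1 (NoDup_nth s O) Hnd); lia || exact E.
  - rewrite H0 by exact Hj; symmetry.
    rewrite (sumR_ext _ _ (fun _ => 0)); [rewrite sumR_const; ring|].
    intros k Hk; destruct (Nat.eqb_spec (nth k s O) j) as [E|]; [|reflexivity].
    destruct Hj; rewrite <- E; apply nth_In; lia.
Qed.

Lemma hull_of_is_phi (d t : nat) (q : nat -> point) (T : list (list nat)) (x : point)
    (alpha : nat -> R) :
  barycentric_nbs d q t T -> inRd d x -> is_phi d q t T x alpha ->
  exists s, In s T /\ simplex_hull d (geom q s) x /\
    forall m, (m <= d)%nat -> alpha (nth m s O) = 0 -> facet d m (geom q s) x.
Proof.
  intros Hnbs Hx [s [Hs [H0 [Hpos [Hsum E]]]]].
  destruct (barycentric_nbs_wf _ _ _ _ Hnbs) as [_ Hwf].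
  destruct (Hwf s Hs) as [Hlen [Hnd Hle]].
  set (lam := fun k => alpha (nth k s O)).
  assert (L2 : sumR (S d) lam = 1).
  { rewrite <- Hsum, (sumR_ext (S t) alpha (fun j => alpha j * 1)) by (intros; ring).
    rewrite (sumR_supported d t s alpha (fun _ => 1)) by assumption.
    apply sumR_ext; intros; unfold lam; ring. }
  assert (L3 : forall i, (i < d)%nat -> x i = sumR (S d) (fun k => lam k * geom q s k i)).
  { intros i Hi; rewrite (E i Hi).
    now rewrite (sumR_supported d t s alpha (fun j => q j i)). }
  exists s; split; [exact Hs|split].
  - split; [exact Hx|]; exists lam; repeat split; [intros; apply Hpos|exact L2|exact L3].
  - intros m Hm Hz; split; [exact Hx|]; exists lam.
    repeat split; [intros; apply Hpos|exact L2|exact Hz|exact L3].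
Qed.

(** All finite weights are 0, so the inequality only asks that the support of alpha avoid the
    vertices of weight -oo. A point of P lies in a simplex that meets P, whose center is allowed. A
    point outside P is either in a simplex that meets P, hence mixed, or has coordinate 0 at a
    forbidden center. *)
Lemma nbs_outer_approximation (d n : nat) (v : nat -> point) (P : point -> Prop) :
  (forall x, P x -> simplex_hull d v x) ->
  exists t q T w, (d <= t)%nat /\ (forall j, (j <= d)%nat -> q j = v j) /\
    barycentric_nbs d q t T /\
    (forall x, P x -> tildeP d v q t T w x) /\
    (forall x, tildeP d v q t T w x -> ~ P x ->
       mixed_level d P n (geom v (seq 0 (S d))) x \/
       facet_level d n (geom v (seq 0 (S d))) x).
Proof.
  intros HPS; set (V := geom v (seq 0 (S d))).
  destruct (full_subdivision_exists d n v) as [q [t [T [Hq [Hnbs [Hgeom Hcov]]]]]].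
  fold V in Hgeom, Hcov.
  destruct (barycentric_nbs_wf _ _ _ _ Hnbs) as [Hdt Hwf].
  destruct (barycentric_nbs_split_all d T q t nil Hnbs) as [q' [A1 [A2 A3]]]; simpl app in A2.
  assert (Hg : forall s, In s T -> geom q' s = geom q s).
  { intros s Hs; destruct (Hwf s Hs) as [L1 [_ L2]]; now apply geom_ext with d t. }
  set (meets := fun s => exists x, simplex_hull d (geom q' s) x /\ P x).
  (* An index j > t is the center of the simplex at position j - S t of T. *)
  set (w := fun j => if Nat.leb j t then Some 0
    else if excluded_middle_informative (meets (nth (j - S t) T nil)) then Some 0 else None).
  assert (Hw : forall j, w j = Some 0 \/ w j = None).
  { intros j; unfold w; destruct (Nat.leb j t); [now left|].
    destruct excluded_middle_informative; auto. }
  assert (Hw_old : forall j, (j <= t)%nat -> w j = Some 0).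
  { intros j Hj; unfold w; destruct (Nat.leb_spec j t); [reflexivity|lia]. }
  assert (Hw_new : forall i, w (S t + i)%nat =
    if excluded_middle_informative (meets (nth i T nil)) then Some 0 else None).
  { intros i; unfold w; destruct (Nat.leb_spec (S t + i) t); [lia|].
    replace (S t + i - S t)%nat with i by lia; reflexivity. }
  exists (t + length T)%nat, q', (split_all t T), w.
  split; [lia|]; split; [intros j Hj; rewrite A1 by lia; auto|].
  split; [exact A2|]; split.
  - intros x HPx; split; [auto|].
    destruct (Hcov x) as [s [Hs Hxs]].
    { destruct (HPS x HPx) as [Hx [lam [H1 [H2 H3]]]]; split; [exact Hx|].
      exists lam; split; [exact H1|]; split; [exact H2|].
      intros i Hi; rewrite (H3 i Hi); apply sumR_ext; intros j Hj; unfold V, geom.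
      rewrite seq_nth by exact Hj; reflexivity. }
    destruct (Hwf s Hs) as [L1 [_ L2]].
    destruct (In_nth T s nil Hs) as [i [Hi Hsi]].
    destruct (hull_cover d (geom q s) x Hxs) as [m [Hm Hxm]].
    rewrite <- Hg in Hxm by exact Hs.
    rewrite <- (geom_replace_nth d m (S t + i)) in Hxm;
      [|exact L1|exact Hm|rewrite A3, Hsi by exact Hi; reflexivity].
    destruct (is_phi_of_hull d (t + length T) q' (split_all t T)
                (replace_nth s m (S t + i)) x A2) as [alpha [Hphi Hsupp]].
    { apply in_split_all; exists i, m; rewrite Hsi; repeat split; lia. }
    { exact Hxm. }
    exists alpha; split; [exact Hphi|split].
    + intros j _ Hj; apply Hsupp, in_replace_nth in Hj; destruct Hj as [->|Hj].
      * rewrite Hw_new, Hsi; destruct excluded_middle_informative as [|Hn]; [discriminate|].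
        destruct Hn; exists x; rewrite Hg by exact Hs; auto.
      * rewrite Hw_old by auto; discriminate.
    + apply sumR_nonneg; intros j _; destruct (Hw j) as [-> | ->]; lra.
  - intros x [[Hx _] [alpha [Hphi [Hfin _]]]] HnP.
    destruct (hull_of_is_phi _ _ _ _ _ _ A2 Hx Hphi) as [s' [Hs' [Hxs' Hfacet]]].
    apply in_split_all in Hs'; destruct Hs' as [i [m [Hi [Hm ->]]]].
    assert (Hs : In (nth i T nil) T) by (apply nth_In; exact Hi).
    set (s := nth i T nil) in *; destruct (Hwf s Hs) as [L1 _].
    assert (Hm' : (m <= d)%nat) by lia.
    assert (Hgs : geom q' (replace_nth s m (S t + i)) = child d (geom q' s) m)
      by (apply geom_replace_nth; auto; apply A3; exact Hi).
    rewrite Hgs in Hxs', Hfacet.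
    destruct (Hgeom s Hs) as [u [U1 [U2 U3]]]; rewrite <- Hg in U3 by exact Hs.
    destruct (excluded_middle_informative (meets s)) as [Hmeet|Hmiss].
    + left; exists u; split; [exact U1|split; [exact U2|]]; rewrite <- U3.
      assert (Hxs : simplex_hull d (geom q' s) x) by (apply hull_child with m; assumption).
      split; [|exact Hxs]; intros [Hin|Hout].
      * apply HnP, Hin, Hxs.
      * destruct Hmeet as [y [Hy HPy]]; exact (Hout y Hy HPy).
    + right; exists u, m; split; [exact U1|split; [exact U2|split; [exact Hm'|]]].
      rewrite <- U3.
      assert (Hal : alpha (nth m (replace_nth s m (S t + i)) O) = 0).
      { rewrite nth_replace_nth, Nat.eqb_refl by lia.
        destruct Hphi as [_ [_ [_ [Hpos _]]]].
        destruct (Rle_lt_or_eq_dec 0 _ (Hpos (S t + i)%nat)) as [Hlt|Heq]; [|now symmetry].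
        destruct (Hfin (S t + i)%nat); [lia|exact Hlt|].
        rewrite Hw_new; fold s; destruct excluded_middle_informative; [contradiction|reflexivity]. }
      (* The facet of a child opposite its center is the facet of the parent opposite vertex m. *)
      destruct (Hfacet m Hm' Hal) as [_ [lam [F1 [F2 [F3 F4]]]]].
      split; [exact Hx|]; exists lam; repeat split; auto.
      intros k Hk; rewrite (F4 k Hk); apply sumR_ext; intros j _; unfold child.
      destruct (Nat.eqb_spec j m) as [->|]; [rewrite F3; ring|reflexivity].
Qed.

(** * Cubes of fixed size and the choice of the depth *)

Lemma dist_le_coordinates (d : nat) (x y : point) (r : R) : (1 <= d)%nat -> 0 <= r ->
  (forall i, (i < d)%nat -> Rabs (x i - y i) <= r / INR d) -> dist d x y <= r.
Proof.
  intros Hd Hr H; assert (HD : 1 <= INR d) by (apply (le_INR 1); lia).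
  apply dist_le; [exact Hr|].
  apply Rle_trans with (sumR d (fun _ => (r / INR d) * (r / INR d))).
  - apply sumR_le; intros i Hi; specialize (H i Hi).
    rewrite <- Rsqr_pow2, Rsqr_abs; unfold Rsqr; apply Rmult_le_compat; auto; apply Rabs_pos.
  - rewrite sumR_const; set (u := r / INR d).
    assert (E : u * INR d = r) by (unfold u; field; lra).
    assert (Hu : 0 <= u) by (apply Rmult_le_pos; [lra|left; apply Rinv_0_lt_compat; lra]).
    rewrite <- E; nra.
Qed.

Lemma hull_bounded (d : nat) (v : nat -> point) :
  exists B, 0 <= B /\ forall x, simplex_hull d v x -> forall i, (i < d)%nat -> Rabs (x i) <= B.
Proof.
  assert (Hpos : forall i, 0 <= sumR (S d) (fun j => Rabs (v j i)))
    by (intros i; apply sumR_nonneg; intros; apply Rabs_pos).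
  exists (sumR d (fun i => sumR (S d) (fun j => Rabs (v j i)))); split;
    [apply sumR_nonneg; auto|].
  intros x [_ [lam [H1 [H2 H3]]]] i Hi; rewrite (H3 i Hi).
  eapply Rle_trans; [apply sumR_abs|].
  eapply Rle_trans; [|apply (sumR_le_term d (fun i => sumR (S d) (fun j => Rabs (v j i))) i);
                      auto].
  apply sumR_le; intros j Hj; rewrite Rabs_mult, <- (Rmult_1_l (Rabs (v j i))) at 1.
  assert (Hl : 0 <= lam j <= 1).
  { split; [apply H1; lia|]; rewrite <- H2; apply sumR_le_term; [|exact Hj].
    intros; apply H1; lia. }
  rewrite (Rabs_right (lam j)) by lra; generalize (Rabs_pos (v j i)); nra.
Qed.

(* Since P contains a ball, a point outside P has a whole cube outside P nearby: move away
   from the center of the ball. *)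
Lemma cube_outside_convex (d : nat) (P : point -> Prop) (o : point) (r tau : R) (x z : point) :
  (1 <= d)%nat -> convex_set d P -> inRd d o -> 0 < r -> 0 < tau ->
  (forall y, ball d o r y -> P y) -> inRd d x -> ~ P x -> inRd d z ->
  (forall i, (i < d)%nat -> x i + tau * (x i - o i) <= z i <=
                            x i + tau * (x i - o i) + tau * r / INR d) ->
  ~ P z.
Proof.
  intros Hd Hconv Ho Hr Htau Hball Hx HnP Hz Hcube HPz; apply HnP.
  assert (HD : 1 <= INR d) by (apply (le_INR 1); lia).
  (* Solves x = (z + tau * o') / (1 + tau). The side tau * r / d of the cube is what keeps o' within
     the ball around o, so z in P would put x in P. *)
  set (o' := fun i => o i + (x i + tau * (x i - o i) - z i) / tau).
  assert (HPo : P o').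
  { apply Hball; split.
    - intros i Hi; unfold o'; rewrite Ho, Hx, Hz by exact Hi; field; lra.
    - apply dist_le_coordinates; [exact Hd|lra|]; intros i Hi; specialize (Hcube i Hi).
      replace (o i - o' i) with ((z i - (x i + tau * (x i - o i))) / tau)
        by (unfold o'; field; lra).
      rewrite Rabs_right.
      + apply Rmult_le_reg_r with tau; [lra|].
        replace ((z i - (x i + tau * (x i - o i))) / tau * tau)
          with (z i - (x i + tau * (x i - o i))) by (field; lra).
        replace (r / INR d * tau) with (tau * r / INR d) by (field; lra); lra.
      + apply Rle_ge, Rmult_le_pos; [lra|left; apply Rinv_0_lt_compat; lra]. }
  assert (Hlam : 0 <= / (1 + tau) <= 1).
  { split; [left; apply Rinv_0_lt_compat; lra|].
    rewrite <- Rinv_1; apply Rinv_le_contravar; lra. }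
  generalize (Hconv z o' (/ (1 + tau)) HPz HPo Hlam).
  replace (fun i => / (1 + tau) * z i + (1 - / (1 + tau)) * o' i) with x; [auto|].
  apply functional_extensionality; intros i; unfold o'; field; lra.
Qed.

Theorem theorem2 :
  forall (d : nat) (v : nat -> point) (P : point -> Prop) (eps : R),
    (1 <= d)%nat ->
    regular_unit_simplex d v ->
    convex_body d P ->
    (forall x, P x -> simplex_hull d v x) ->
    diameter_one d P ->
    0 < eps < 1 ->
    exists (t : nat) (q : nat -> point) (T : list (list nat)) (w : nat -> option R),
      (d <= t)%nat /\
      (forall j, (j <= d)%nat -> q j = v j) /\
      barycentric_nbs d q t T /\
      (forall mS, is_volume d (simplex_hull d v) mS ->
         volume_lt d (fun x => tildeP d v q t T w x /\ ~ P x) (eps * mS)) /\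
      (forall x, shrink d (tildeP d v q t T w) eps x -> P x) /\
      (forall x, P x -> tildeP d v q t T w x).
Proof.
  intros d v P eps Hd _ [HPRd [Hconv [Hclosed [Hbdd [o0 [r [Hr Hball0]]]]]]] HPS _ Heps.
  assert (HD : 1 <= INR d) by (apply (le_INR 1); lia).
  (* Truncating the center of the ball makes it a point of R^d and changes no distance. *)
  set (o := fun i => if Nat.ltb i d then o0 i else 0).
  assert (Ho : inRd d o).
  { intros i Hi; unfold o; destruct (Nat.ltb_spec i d); [lia|reflexivity]. }
  assert (Hball : forall y, ball d o r y -> P y).
  { intros y [Hy Hdist]; apply Hball0; split; [exact Hy|].
    eapply Rle_trans; [apply Req_le|exact Hdist]; unfold dist; f_equal.
    apply sumR_ext; intros i Hi; unfold o; destruct (Nat.ltb_spec i d); [reflexivity|lia]. }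
  assert (HPo : P o).
  { apply Hball; split; [exact Ho|]; apply dist_le_coordinates; [exact Hd|lra|].
    intros i _; rewrite Rminus_diag, Rabs_R0; apply Rmult_le_pos; [lra|].
    left; apply Rinv_0_lt_compat; lra. }
  destruct (hull_bounded d v) as [B [HB HBound]].
  (* Coordinates on S are at most B in absolute value, so the pushed cube at x deviates from x by at
     most tau * 2 * B + tau * r = eps / d per coordinate, and stays in the eps-ball. *)
  set (tau := eps / (INR d * (2 * B + r))).
  assert (Htau : 0 < tau) by (apply Rdiv_lt_0_compat; [|apply Rmult_lt_0_compat]; lra).
  set (h1 := r / INR d); set (h2 := tau * r / INR d).
  assert (Hh1 : 0 < h1) by (apply Rdiv_lt_0_compat; lra).
  assert (Hh2 : 0 < h2) by (apply Rdiv_lt_0_compat; nra).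
  destruct (exists_pure_descendant d P Hconv Hclosed Hbdd) as [K HK].
  set (V := geom v (seq 0 (S d))).
  destruct (image_bound_exists d V Hd) as [c [Hc HV]].
  set (beta := 1 - (/ INR (S d)) ^ K).
  (* The first entry serves the volume estimate, the second the eps-ball claim. Both are fixed by P,
     S and eps before the depth j * K is chosen. *)
  set (tol := Rmin (eps * h1 ^ d) (h2 ^ d)).
  assert (Htol : 0 < tol).
  { assert (0 < h1 ^ d) by (apply pow_lt; lra); assert (0 < h2 ^ d) by (apply pow_lt; lra).
    apply Rmin_glb_lt; [apply Rmult_lt_0_compat; lra|lra]. }
  assert (Hj : exists j, c * beta ^ j < tol).
  { assert (HS := INR_S_pos d); assert (HS1 : 1 <= INR (S d)) by (apply (le_INR 1); lia).
    assert (Hi : 0 < / INR (S d) <= 1).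
    { split; [apply Rinv_0_lt_compat; lra|rewrite <- Rinv_1; apply Rinv_le_contravar; lra]. }
    assert (HpK : 0 < (/ INR (S d)) ^ K <= 1).
    { split; [apply pow_lt; lra|]; rewrite <- (pow1 K); apply pow_incr; lra. }
    destruct (pow_lt_1_zero beta) with (y := tol / (c + 1)) as [j Hj].
    { unfold beta; rewrite Rabs_right; lra. }
    { apply Rdiv_lt_0_compat; lra. }
    specialize (Hj j (Nat.le_refl j)); apply Rabs_def2 in Hj; exists j.
    assert (0 <= beta ^ j) by (apply pow_le; unfold beta; lra).
    assert (E : tol / (c + 1) * (c + 1) = tol) by (field; lra).
    destruct Hj; nra. }
  destruct Hj as [j Hj].
  destruct (nbs_outer_approximation d (j * K) v P HPS)
    as [t [q [T [w [Ht [Hq [Hnbs [Hsub Hdiff]]]]]]]].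
  fold V in Hdiff.
  assert (Hcontent : content_le d (fun x => tildeP d v q t T w x /\ ~ P x) (c * beta ^ j)).
  { rewrite <- Rplus_0_r; eapply content_le_weaken;
      [apply content_le_union;
         [apply (mixed_content_decay d P Hd K HK j V c Hc HV)
         |apply (content_le_facet_level d (j * K) V c Hd Hc HV)]
      | |apply Rle_refl].
    intros x [Hx HnP]; apply Hdiff; assumption. }
  exists t, q, T, w; repeat (split; [assumption|]); split; [|split; [|exact Hsub]].
  - intros mS [_ HmS]; apply volume_lt_content with (c * beta ^ j); [exact Hd|exact Hcontent|].
    (* The cube of side h1 = r / d with corner o lies in the ball inside P, so every box cover of S
       has volume at least h1 ^ d. *)
    assert (HmS1 : h1 ^ d <= mS).
    { apply HmS; intros L [a [b Hcov]]; apply (box_cover_cube d _ a b L o h1 Hcov Hh1).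
      intros x Hx Hcube; apply HPS, Hball; split; [exact Hx|].
      apply dist_le_coordinates; [exact Hd|lra|]; intros i Hi; specialize (Hcube i Hi).
      fold h1; rewrite Rabs_minus_sym; apply Rabs_le; lra. }
    assert (eps * h1 ^ d <= eps * mS) by (apply Rmult_le_compat_l; lra).
    generalize (Rmin_l (eps * h1 ^ d) (h2 ^ d)); fold tol; lra.
  - intros x [[HxS Hphi] Hshrink]; apply NNPP; intros HnP.
    destruct (volume_lt_content d _ _ (h2 ^ d) Hd Hcontent) as [a [b [L [Hcov HL]]]].
    { generalize (Rmin_r (eps * h1 ^ d) (h2 ^ d)); fold tol; lra. }
    assert (Hx : inRd d x) by apply HxS.
    (* The difference has a cover of volume L < h2 ^ d, yet it would contain the cube of side h2
       beyond x. *)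
    enough (h2 ^ d <= L) by lra.
    apply (box_cover_cube d _ a b L (fun i => x i + tau * (x i - o i)) h2 Hcov Hh2).
    intros z Hz Hcube; split.
    + apply Hshrink; split; [exact Hz|].
      apply dist_le_coordinates; [exact Hd|lra|]; intros i Hi; specialize (Hcube i Hi).
      assert (B1 := HBound x HxS i Hi); assert (B2 := HBound o (HPS o HPo) i Hi).
      apply Rabs_le_inv in B1; apply Rabs_le_inv in B2.
      assert (E : tau * (2 * B + r) = eps / INR d) by (unfold tau; field; lra).
      assert (Hh : h2 <= tau * r).
      { unfold h2; apply Rmult_le_reg_r with (INR d); [lra|].
        replace (tau * r / INR d * INR d) with (tau * r) by (field; lra).
        assert (0 < tau * r) by (apply Rmult_lt_0_compat; lra); nra. }
      rewrite <- E, Rabs_minus_sym; apply Rabs_le.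
      assert (- (tau * (2 * B)) <= tau * (x i - o i) <= tau * (2 * B)) by (split; nra).
      lra.
    + apply (cube_outside_convex d P o r tau x z); assumption.
Qed.
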